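(* Let $n\ge1$ and let $c,d$ be complex parameters. The two sequences (indexed by $n$-tuples $\boldsymbol k$ of nonnegative integers) \begin{align*} \alpha_{\boldsymbol k}(a,b)&:=\prod_{r=1}^n\frac{\theta(ax_rq^{k_r+|\boldsymbol k|};p)}{\theta(ax_r;p)}\frac{(ax_r;q,p)_{|\boldsymbol k|}}{(ax_rq/c,\,ax_rq/d,\,bcdx_r/a;q,p)_{k_r}}\\ &\quad\times\frac{(c,\,d,\,qa^2/(bcd);q,p)_{|\boldsymbol k|}}{\prod_{r,s=1}^n(qx_r/x_s;q,p)_{k_r}}\left(\frac ba\right)^{|\boldsymbol k|}q^{-\sum_{r<s}k_rk_s}\prod_{r=1}^nx_r^{k_r} \end{align*} and $$\beta_{\boldsymbol k}(a,b):=\prod_{r,s=1}^n\frac{(bx_rx_s;q,p)_{k_s}}{(qx_r/x_s;q,p)_{k_r}}\prod_{r=1}^n\frac{(ax_rq/(cd),\,bcx_r/a,\,bdx_r/a;q,p)_{k_r}}{(bcdx_r/a,\,ax_rq/c,\,ax_rq/d;q,p)_{k_r}}$$ form a WP Bailey pair with respect to the matrix $\mathbf B^{(4)}$.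
   Context: Let $q,p$ be complex numbers with $q\neq 0$ and $|p|<1$. For $a\ne 0$ put $\theta(a;p)=\prod_{j\ge 0}(1-ap^j)(1-p^{j+1}/a)$. For an integer $k$ the $q,p$-shifted factorial is $(a;q,p)_k=\prod_{j=0}^{k-1}\theta(aq^j;p)$ if $k\ge 0$ (empty product $=1$), and $(a;q,p)_{k}=\big(\prod_{j=k}^{-1}\theta(aq^{j};p)\big)^{-1}$ if $k<0$. Write $(a_1,\dots,a_m;q,p)_k=(a_1;q,p)_k\cdots(a_m;q,p)_k$. For a tuple $\boldsymbol k=(k_1,\dots,k_n)$, $|\boldsymbol k|=k_1+\cdots+k_n$; $\sum_{r<s}$ is over $1\le r<s\le n$. The $x_1,\dots,x_n$ are fixed complex parameters. All parameters are nonzero and generic in the sense that no denominators vanish. WP Bailey pair: given a matrix $\mathbf B=(B_{\boldsymbol k\boldsymbol j}(a,b))$ indexed by $n$-tuples of nonnegative integers, sequences $\alpha_{\boldsymbol N}(a,b)$ and $\beta_{\boldsymbol N}(a,b)$ form a WP Bailey pair with respect to $\mathbf B$ if for all $n$-tuples $\boldsymbol N$ of nonnegative integers $$\beta_{\boldsymbol N}(a,b)=\sum_{0\le j_r\le N_r,\ r=1,\dots,n}B_{\boldsymbol N\boldsymbol j}(a,b)\,\alpha_{\boldsymbol j}(a,b).$$ The matrix $\mathbf B^{(4)}$ has entries $$B^{(4)}_{\boldsymbol k\boldsymbol j}(a,b)=\frac{\prod_{r,s=1}^n(bx_rx_s;q,p)_{k_r+j_s}}{\prod_{1\le r<s\le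 n}(bx_rx_s;q,p)_{j_r+j_s}\prod_{r,s=1}^n(q^{1+j_r-j_s}x_r/x_s;q,p)_{k_r-j_r}}\prod_{r=1}^n\frac{(bx_r/a;q,p)_{k_r-|\boldsymbol j|}}{(bx_r/a;q,p)_{j_r-|\boldsymbol j|}(ax_rq;q,p)_{k_r+|\boldsymbol j|}}.$$ *)

(* Defs.v *)
(* MathComp and MathComp-Analysis. *)
From mathcomp Require Import all_boot all_order all_algebra.
From mathcomp Require Import complex.
From mathcomp Require Import boolp classical_sets functions reals.
From mathcomp Require Import topology normedtype sequences.

Set Implicit Arguments.
Unset Strict Implicit.
Unset Printing Implicit Defensive.

Import Order.TTheory GRing.Theory Num.Theory numFieldNormedType.Exports.

Local Open Scope classical_set_scope.
Local Open Scope ring_scope.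

(* The definitions are stated over a [numFieldType] [C]: its norm topology is
   the one MathComp-Analysis provides, and for [C := R[i]] with [R : realType]
   it is the usual topology of the complex numbers. *)

Definition theta (C : numFieldType) (p a : C) : C :=
  lim ((\prod_(0 <= j < m) ((1 - a * p ^+ j) * (1 - p ^+ j.+1 / a)))
         @[m --> \oo]).

(* [Negz m] is the integer -(m+1); the exponents -(m+1), ..., -1 are
   enumerated as -(j+1) for 0 <= j <= m. Since 0^-1 = 0, this factorial at a
   negative index is nonzero exactly when none of its denominators vanishes. *)
Definition qpfac (C : numFieldType) (q p a : C) (k : int) : C :=
  match k with
  | Posz m => \prod_(0 <= j < m) theta p (a * q ^+ j)
  | Negz m => (\prod_(0 <= j < m.+1) theta p (a * q ^- j.+1))^-1
  end.

Definition qpfacs (C : numFieldType) (q p : C) (s : seq C) (k : int) : C :=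
  \prod_(a <- s) qpfac q p a k.

Definition weight (n : nat) (k : 'I_n -> nat) : nat := (\sum_(r < n) k r)%N.

Definition WP_Bailey_pair (C : numFieldType) (n : nat)
    (B : ('I_n -> nat) -> ('I_n -> nat) -> C)
    (alpha beta : ('I_n -> nat) -> C) : Prop :=
  forall N : 'I_n -> nat,
    beta N = \sum_(j : {dffun forall r : 'I_n, 'I_(N r).+1})
               B N (fun r => j r : nat) * alpha (fun r => j r : nat).

Definition B4 (C : numFieldType) (n : nat) (q p : C) (x : 'I_n -> C) (a b : C)
    (k j : 'I_n -> nat) : C :=
  (\prod_(r < n) \prod_(s < n) qpfac q p (b * x r * x s) (k r + j s)%N)
  / ((\prod_(r < n) \prod_(s < n | (r < s)%N)
        qpfac q p (b * x r * x s) (j r + j s)%N)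
     * (\prod_(r < n) \prod_(s < n)
          qpfac q p (q ^ (1 + (j r)%:Z - (j s)%:Z) * x r / x s)
                    ((k r)%:Z - (j r)%:Z)))
  * \prod_(r < n)
      (qpfac q p (b * x r / a) ((k r)%:Z - (weight j)%:Z)
       / (qpfac q p (b * x r / a) ((j r)%:Z - (weight j)%:Z)
          * qpfac q p (a * x r * q) (k r + weight j)%N)).

Definition alpha4 (C : numFieldType) (n : nat) (q p : C) (x : 'I_n -> C)
    (c d a b : C) (k : 'I_n -> nat) : C :=
  (\prod_(r < n)
     (theta p (a * x r * q ^+ (k r + weight k)) / theta p (a * x r)
      * (qpfac q p (a * x r) (weight k)
         / qpfacs q p [:: a * x r * q / c; a * x r * q / d;
                          b * c * d * x r / a] (k r))))
  * (qpfacs q p [:: c; d; q * a ^+ 2 / (b * c * d)] (weight k)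
     / \prod_(r < n) \prod_(s < n) qpfac q p (q * x r / x s) (k r))
  * (b / a) ^+ weight k
  * q ^- (\sum_(r < n) \sum_(s < n | (r < s)%N) k r * k s)%N
  * \prod_(r < n) x r ^+ k r.

Definition beta4 (C : numFieldType) (n : nat) (q p : C) (x : 'I_n -> C)
    (c d a b : C) (k : 'I_n -> nat) : C :=
  (\prod_(r < n) \prod_(s < n)
     (qpfac q p (b * x r * x s) (k s) / qpfac q p (q * x r / x s) (k r)))
  * \prod_(r < n)
      (qpfacs q p [:: a * x r * q / (c * d); b * c * x r / a;
                      b * d * x r / a] (k r)
       / qpfacs q p [:: b * c * d * x r / a; a * x r * q / c;
                        a * x r * q / d] (k r)).

(* Main.v *)
Require Import Defs.
From mathcomp Require Import all_boot all_order all_algebra.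
From mathcomp Require Import complex.
From mathcomp Require Import boolp classical_sets reals.
From mathcomp Require Import topology normedtype sequences exp.
From mathcomp Require Import ring lra zify.
Set Implicit Arguments.
Unset Strict Implicit.
Unset Printing Implicit Defensive.

Import Order.TTheory GRing.Theory Num.Theory numFieldNormedType.Exports.
Local Open Scope ring_scope.
Local Open Scope complex_scope.

(** After multiplication by a factor that does not depend on j, the relation for
    N is a multiple elliptic Jackson summation [elliptic_jackson]: a sum over
    0 <= j_r <= N_r with three parameters c, d, e such that b c d e = q a^2.

    It is proved by induction on |N| and interpolation in c. For fixed d, put
    K = q a^2 / (b d), so that e = K / c. Both sides are combinations of products of
    |N| factors theta (u c) * theta (u K / c), and by the three-term relation every
    such product is, in terms of two fixed factors of this form, a homogeneous
    polynomial of degree |N|. Hence it suffices to compare the two sides at |N| + 1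
    points ([theta_degree_interpolation]). At c = 1 only the term with j = 0
    remains. At c = a x_r q^i with 1 <= i <= N_r only the terms with j_r >= i remain;
    put j_r = j'_r + i. The numbers a q^|j|, x_s q^(j_s) and x_s q^(N_s), on which most
    factors depend, are unchanged if a and x_r are replaced by a q^i and x_r q^i and
    N_r by N_r - i. The remaining factors are attached symmetrically to the
    parameters a x_1, ..., a x_n, c, d, e, and for the chosen c the replacement just
    exchanges a x_r and c. So the sum is a multiple of a sum of the same kind over
    a smaller box ([jackson_sum_shift]), which is known by induction. The points
    are distinct for the interpolation only if d is in general position; since the
    two sides are symmetric in c and d, interpolation in d yields all other d.

    This uses four properties of theta ([theta_like]): theta 1 = 0, the inversion
    formula, the existence of points in general position (the zeros of theta have
    moduli in a geometric progression), and the three-term relation. For the last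
    one, fix y and let G (x) = theta (x y) * theta (x / y). Since G (p x) = x^-2 G (x), the
    Laurent coefficients of G satisfy g_(k + 2) = p^k g_k, so that G is a combination
    of two functions that do not depend on y ([pair_part_approx]). The matrix
    theta (x_i x_j) * theta (x_i / x_j) therefore has rank at most two; it is
    antisymmetric up to the scaling of its rows, and the vanishing of its 3 x 3
    minors forces its Pfaffian to vanish, which is the three-term relation. The
    coefficients are handled on truncated products, which are polynomials up to a
    power of x and satisfy the same relations up to terms of order p^m. *)

Import Normc.

(** * Limits of complex sequences *)

Section ComplexLimits.
Local Open Scope classical_set_scope.
Variable R : realType.
Local Notation C := (R[i] : numFieldType).

Lemma normcE (z : R[i]) : `|z| = (normc z)%:C.
Proof. by case: z. Qed.

Lemma normc_ge0 (z : R[i]) : 0 <= normc z.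
Proof. by rewrite -ler0c -normcE. Qed.

Lemma normc_gt0 (z : R[i]) : z != 0 -> 0 < normc z.
Proof.
move=> z0; rewrite lt_neqAle normc_ge0 andbT eq_sym.
by apply: contra z0 => /eqP/eq0_normc ->.
Qed.

Lemma normc_sum (I : Type) (s : seq I) (P : pred I) (F : I -> R[i]) :
  normc (\sum_(i <- s | P i) F i) <= \sum_(i <- s | P i) normc (F i).
Proof.
apply: (big_ind2 (fun (x : R[i]) y => normc x <= y)) => //; first by rewrite normc0.
by move=> x y x' y' h h'; rewrite (le_trans (le_normcD _ _)) ?lerD.
Qed.

Lemma normc_prod (I : Type) (s : seq I) (P : pred I) (F : I -> R[i]) :
  normc (\prod_(i <- s | P i) F i) = \prod_(i <- s | P i) normc (F i).
Proof. by apply: (big_morph _ (@normcM R) (@normc1 R)). Qed.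

Lemma normcX (z : R[i]) n : normc (z ^+ n) = normc z ^+ n.
Proof. by elim: n => [|n IH]; rewrite ?normc1 // !exprS normcM IH. Qed.

(** Convergence of complex sequences is reduced to that of real ones, where the
    order is total and the usual estimates apply. *)
Lemma cvg_normcP (u : nat -> C) (l : C) :
  (u @ \oo --> l) <-> ((fun m => normc (u m - l)) @ \oo --> (0 : R)).
Proof.
split=> [/cvgrPdist_lt h | /cvgrPdist_lt h]; apply/cvgrPdist_lt => e e0.
- have e0' : 0 < (e%:C : C) by rewrite ltcR.
  near=> m; rewrite sub0r normrN ger0_norm ?normc_ge0 // -ltcR -normcE.
  by rewrite distrC; near: m; exact: h.
- have := e0; rewrite ltcE /= => /andP[/eqP Ime Ree].
  have eE : (e : R[i]) = (complex.Re e)%:C by case: (e) Ime => a b /= ->.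
  near=> m; rewrite eE distrC normcE ltcR.
  suff : `|0 - normc (u m - l)| < complex.Re e.
    by rewrite sub0r normrN ger0_norm ?normc_ge0.
  by near: m; exact: h.
Unshelve. all: by end_near. Qed.

Lemma cvg_normc (u : nat -> C) (l : C) :
  u @ \oo --> l -> (fun m => normc (u m)) @ \oo --> (normc l : R).
Proof.
move=> /cvg_normcP /cvgrPdist_lt h; apply/cvgrPdist_lt => e e0.
near=> m; have : `|0 - normc (u m - l)| < e by near: m; exact: h.
rewrite sub0r normrN ger0_norm ?normc_ge0 //; apply: le_lt_trans.
have h1 := le_normcD (u m - l) l; have h2 := le_normcD (l - u m) (u m).
rewrite subrK in h1; rewrite subrK in h2.
have e1 : normc (l - u m) = normc (u m - l) by rewrite -normcN opprB.
by rewrite ler_norml; apply/andP; split; lra.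
Unshelve. all: by end_near. Qed.

Lemma cvg_Re_Im (u : nat -> C) (a b : R) :
  (fun m => complex.Re (u m)) @ \oo --> a -> (fun m => complex.Im (u m)) @ \oo --> b ->
  u @ \oo --> (a +i* b : C).
Proof.
move=> ha hb; apply/cvg_normcP.
have h0 : (fun m => `|complex.Re (u m) - a| + `|complex.Im (u m) - b|) @ \oo --> (0 : R).
  rewrite -[0]addr0 -(normr0 R) -{1}(subrr a) -(subrr b).
  by apply: cvgD; apply: cvg_norm; apply: cvgB => //; exact: cvg_cst.
apply: squeeze_cvgr (cvg_cst 0) h0.
near=> m; rewrite normc_ge0 /=.
case: (u m) => x y /=.
have -> : `|x - a| + `|y - b| = Num.sqrt ((`|x - a| + `|y - b|) ^+ 2).
  by rewrite sqrtr_sqr [RHS]ger0_norm ?addr_ge0.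
rewrite ler_sqrt ?sqr_ge0 // [leRHS]sqrrD !real_normK ?num_real // lerD2r.
by rewrite lerDl mulrn_wge0 // mulr_ge0.
Unshelve. all: by end_near. Qed.

(** Completeness of the complex plane: the real and the imaginary part of u are
    absolutely convergent series. *)
Lemma cvgn_abs_telescope (u : nat -> C) (v : nat -> R) :
  (forall m, normc (u m.+1 - u m) <= v m) -> cvgn (series v) -> cvgn u.
Proof.
move=> huv hv.
have v0 m : 0 <= v m by exact: le_trans (normc_ge0 _) (huv m).
have key (f : nat -> R) : (forall m, `|f m.+1 - f m| <= v m) -> cvgn f.
  move=> hf; have -> : f = (fun n => f 0%N + series (telescope f) n).
    by apply/funext => n; exact: eq_sum_telescope.
  apply: is_cvgD; first exact: is_cvg_cst.
  apply: normed_cvg; apply: series_le_cvg hv => // m.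
  exact: normr_ge0.
have /cvg_ex[a ha] : cvgn (fun m => complex.Re (u m)).
  apply: key => m; apply: le_trans (huv m); rewrite -lecR -normcE.
  apply: le_trans (normc_ge_Re _); rewrite lecR; case: (u m.+1) (u m) => ? ? [] //.
have /cvg_ex[b hb] : cvgn (fun m => complex.Im (u m)).
  apply: key => m; apply: le_trans (huv m); rewrite -lecR -normcE.
  case: (u m.+1) (u m) => x y [x' y'] /=.
  rewrite lecR /= -(sqrtr_sqr (y - y')) ler_sqrt ?lerDr ?sqr_ge0 //.
  by rewrite addr_ge0 ?sqr_ge0.
by apply/cvg_ex; exists (a +i* b); exact: cvg_Re_Im.
Qed.

Lemma cvgC_unique (u : nat -> C) (l l' : C) :
  u @ \oo --> l -> u @ \oo --> l' -> l = l'.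
Proof. exact: (cvg_unique (@norm_hausdorff _ C)). Qed.

Lemma cvgCM (u v : nat -> C) (l l' : C) :
  u @ \oo --> l -> v @ \oo --> l' -> (fun m => u m * v m) @ \oo --> l * l'.
Proof. by move=> hu hv; exact: cvgM hu hv. Qed.

Lemma cvgCD (u v : nat -> C) (l l' : C) :
  u @ \oo --> l -> v @ \oo --> l' -> (fun m => u m + v m) @ \oo --> l + l'.
Proof. by move=> hu hv; exact: cvgD hu hv. Qed.

Lemma cvgCB (u v : nat -> C) (l l' : C) :
  u @ \oo --> l -> v @ \oo --> l' -> (fun m => u m - v m) @ \oo --> l - l'.
Proof. by move=> hu hv; exact: cvgB hu hv. Qed.

Lemma cvgC_cst (k : C) : (fun _ : nat => k) @ \oo --> k.
Proof. exact: cvg_cst. Qed.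
End ComplexLimits.

(** * Convergence of infinite products *)

Section InfiniteProducts.
Local Open Scope classical_set_scope.
Variables (R : realType) (c r : R) (z : nat -> R[i]).
Hypotheses (c0 : 0 <= c) (r0 : 0 <= r) (r1 : r < 1).
Hypothesis hz : forall j, normc (z j) <= c * r ^+ j.

Lemma sum_geometric_le m : \sum_(0 <= j < m) c * r ^+ j <= c / (1 - r).
Proof.
have r1' : 0 < 1 - r by rewrite subr_gt0.
have -> : \sum_(0 <= j < m) c * r ^+ j = c * (1 - r ^+ m) / (1 - r).
  elim: m => [|m IH]; first by rewrite big_nil expr0 subrr mulr0 mul0r.
  by rewrite big_nat_recr //= IH exprS; field; rewrite gt_eqF.
by rewrite ler_pM2r ?invr_gt0 // ler_piMr // gerBl exprn_ge0.
Qed.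

(** By the inequality 1 + t <= exp t, factor by factor. *)
Lemma prod_geometric_le m :
  \prod_(0 <= j < m) (1 + c * r ^+ j) <= expR (c / (1 - r)).
Proof.
apply: le_trans (_ : expR (\sum_(0 <= j < m) c * r ^+ j) <= _); last first.
  by rewrite ler_expR sum_geometric_le.
elim: m => [|m IH]; first by rewrite !big_nil expR0.
rewrite !big_nat_recr //= expRD ler_pM ?expR_ge1Dx //.
  by apply: prodr_ge0 => j _; rewrite addr_ge0 // mulr_ge0 ?exprn_ge0.
by rewrite addr_ge0 // mulr_ge0 ?exprn_ge0.
Qed.

Let P m : R[i] := \prod_(0 <= j < m) (1 + z j).

Lemma normc_prod_le m : normc (P m) <= expR (c / (1 - r)).
Proof.
apply: le_trans (prod_geometric_le m); rewrite /P normc_prod.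
apply: ler_prod => j _; rewrite normc_ge0 /=.
by rewrite (le_trans (le_normcD _ _)) // normc1 lerD2l.
Qed.

Lemma cvgn_prod : cvgn (P : nat -> (R[i] : numFieldType)).
Proof.
apply: (@cvgn_abs_telescope _ _ (geometric (expR (c / (1 - r)) * c) r)).
  move=> m; rewrite /P big_nat_recr //= mulrDr mulr1 addrAC subrr add0r normcM.
  by rewrite -mulrA ler_pM ?normc_ge0 ?normc_prod_le.
by apply: is_cvg_geometric_series; rewrite ger0_norm.
Qed.

(** The inequality (1 - s) (1 - t) >= 1 - s - t, iterated. *)
Lemma normc_prod_ge (J m : nat) : (J <= m)%N ->
  normc (P J) * (1 - \sum_(J <= j < m) c * r ^+ j) <= normc (P m).
Proof.
move=> /subnKC <-; elim: (m - J)%N => [|k IH].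
  by rewrite addn0 big_geq // subr0 mulr1.
rewrite addnS big_nat_recr ?leq_addr //= /P big_nat_recr //= normcM.
set s := \sum_(J <= i < _) _ in IH *; set t := c * r ^+ _.
have t0 : 0 <= t by rewrite mulr_ge0 ?exprn_ge0.
have h1 : 1 - t <= normc (1 + z (J + k)).
  have := le_normcD (1 + z (J + k)) (- z (J + k)).
  by rewrite addrK normc1 normcN; have := hz (J + k); rewrite -/t; lra.
have s0 : 0 <= s by apply: sumr_ge0 => j _; rewrite mulr_ge0 ?exprn_ge0.
have p0 := normc_ge0 (P J); have q0 := normc_ge0 (P (J + k)).
have w0 := normc_ge0 (1 + z (J + k)).
rewrite -/(P (J + k)) -/(P J).
have [t1|t1] := leP t 1; last first.
  apply: le_trans (_ : 0 <= _); last by rewrite mulr_ge0.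
  by rewrite mulr_ge0_le0 //; lra.
apply: le_trans (_ : normc (P (J + k)) * (1 - t) <= _); last by rewrite ler_wpM2l.
apply: le_trans (_ : normc (P J) * (1 - s) * (1 - t) <= _); last first.
  by rewrite ler_wpM2r // subr_ge0.
rewrite -mulrA ler_wpM2l //.
have : 0 <= s * t by rewrite mulr_ge0.
by lra.
Qed.

(** The tail of the product beyond a suitable index J stays within a factor 2
    of 1, so that only a vanishing factor can make the limit vanish. *)
Lemma lim_prod_neq0 (l : (R[i] : numFieldType)) : (forall j, 1 + z j != 0) ->
  (P : nat -> (R[i] : numFieldType)) @ \oo --> l -> l != 0.
Proof.
move=> hne hl.
have [J hJ] : exists J, c * r ^+ J / (1 - r) <= 2^-1.
  have : (fun J => c / (1 - r) * r ^+ J) @ \oo --> (0 : R).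
    by apply: cvg_geometric; rewrite ger0_norm.
  move=> /cvgrPdist_lt /(_ 2^-1); case; first by rewrite invr_gt0.
  move=> J _ /(_ J (leqnn _)) /=; rewrite sub0r normrN => /ltW.
  by move=> /(le_trans (ler_norm _)) hJ; exists J; rewrite mulrAC.
have hsum m : \sum_(J <= j < m) c * r ^+ j <= 2^-1.
  apply: le_trans hJ; have r1' : 0 < 1 - r by rewrite subr_gt0.
  have [hm|hm] := leqP m J; last first.
    rewrite -(subnKC (ltnW hm)); elim: (m - J)%N => [|k].
      by rewrite addn0 big_geq // divr_ge0 ?mulr_ge0 ?exprn_ge0 ?(ltW r1').
    move=> _; rewrite -[J in X in X <= _]add0n big_addn addKn.
    rewrite (eq_bigr (fun j => r ^+ J * (c * r ^+ j))) => [|j _]; last first.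
      by rewrite exprD; ring.
    rewrite -mulr_sumr -mulrA mulrCA ler_wpM2l ?exprn_ge0 //.
    exact: sum_geometric_le.
  by rewrite big_geq // divr_ge0 ?mulr_ge0 ?exprn_ge0 ?(ltW r1').
have P0 : 0 < normc (P J).
  apply: normc_gt0; rewrite /P big_mkord.
  by apply/prodf_neq0 => j _; exact: hne.
have : normc (P J) / 2 <= normc l.
  have hnear : \forall m \near \oo, normc (P J) / 2 <= normc (P m).
    exists J => // m /= hm; apply: le_trans (normc_prod_ge hm).
    by rewrite ler_wpM2l ?normc_ge0 //; have := hsum m; lra.
  exact: (closed_cvg _ (@closed_ge _ _) hnear _ (cvg_normc hl)).
have [->|//] := eqVneq l 0; rewrite normc0 => h; exfalso.
have hP : 0 < normc (P J) / 2 by rewrite divr_gt0.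
by have := lt_le_trans hP h; rewrite ltxx.
Qed.
End InfiniteProducts.

(** * The theta function: convergence, inversion and zeros *)

Section ThetaBasics.
Local Open Scope classical_set_scope.
Variables (R : realType) (p : R[i]).
Local Notation C := (R[i] : numFieldType).
Hypothesis hp : normc p < 1.

Definition theta_part (a : R[i]) (m : nat) : R[i] :=
  \prod_(0 <= j < m) ((1 - a * p ^+ j) * (1 - p ^+ j.+1 / a)).

Let dev (a : R[i]) (j : nat) : R[i] :=
  a * p ^+ j * (p ^+ j.+1 / a) - a * p ^+ j - p ^+ j.+1 / a.

Let theta_partE a : theta_part a = (fun m => \prod_(0 <= j < m) (1 + dev a j)).
Proof. by apply/funext => m; apply: eq_bigr => j _; rewrite /dev; ring. Qed.

Let dev_cst (a : R[i]) : R :=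
  normc a * (normc p * normc a^-1) + normc a + normc p * normc a^-1.

Let dev_cst_ge0 a : 0 <= dev_cst a.
Proof. by rewrite /dev_cst !addr_ge0 ?mulr_ge0 ?normc_ge0. Qed.

Let dev_le a j : normc (dev a j) <= dev_cst a * normc p ^+ j.
Proof.
have p0 := normc_ge0 p; have a0 := normc_ge0 a; have b0 := normc_ge0 a^-1.
have pj0 : 0 <= normc p ^+ j by rewrite exprn_ge0.
have pj1 : normc p ^+ j <= 1 by rewrite exprn_ile1 // ltW.
rewrite /dev; apply: le_trans (le_normcD _ _) _.
rewrite /dev_cst mulrDl normcN !normcM !normcX [normc p ^+ _.+1]exprS; apply: lerD; last by lra.
apply: le_trans (le_normcD _ _) _; rewrite mulrDl normcN !normcM !normcX.
rewrite lerD2r exprS; set P := normc p ^+ j in pj0 pj1 *.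
have -> : normc a * P * (normc p * P * normc a^-1) =
   normc a * (normc p * normc a^-1) * P * P by ring.
by rewrite ler_piMr // !mulr_ge0.
Qed.

Lemma theta_cvg (a : R[i]) : (theta_part a : nat -> C) @ \oo --> (theta p a : C).
Proof.
rewrite theta_partE.
have := cvgn_prod (dev_cst_ge0 a) (normc_ge0 p) hp (@dev_le a).
by rewrite -theta_partE => h; exact: h.
Qed.

Lemma theta_eq0 (a : R[i]) : theta p a = 0 ->
  exists j, a * p ^+ j = 1 \/ p ^+ j.+1 / a = 1.
Proof.
move=> h; apply: contrapT => hne.
have : theta p a != 0.
  apply: (lim_prod_neq0 (dev_cst_ge0 a) (normc_ge0 p) hp (@dev_le a)).
    move=> j; have -> : 1 + dev a j = (1 - a * p ^+ j) * (1 - p ^+ j.+1 / a).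
      by rewrite /dev; ring.
    rewrite mulf_neq0 // subr_eq0 eq_sym; apply/eqP => hj; apply: hne.
      by exists j; left.
    by exists j; right.
  by rewrite -theta_partE; exact: theta_cvg.
by rewrite h eqxx.
Qed.

Lemma cvg_pX : ((fun m => p ^+ m) : nat -> C) @ \oo --> (0 : C).
Proof.
apply/cvg_normcP; under eq_fun do rewrite subr0 normcX.
by apply: cvg_expr; rewrite ger0_norm ?normc_ge0.
Qed.

Lemma theta_1 : theta p 1 = 0.
Proof.
apply: (@cvgC_unique R (theta_part 1)); first exact: theta_cvg.
have h : \forall m \near \oo, theta_part 1 m = 0.
  exists 1%N => // m /=; case: m => // m _.
  by rewrite /theta_part big_nat_recl //= expr0 mul1r subrr !mul0r.
by apply: cvg_near_cst; exact: h.
Qed.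

(** The truncated products at a and at the inverse of a differ by two boundary
    factors, which tend to 1. *)
Lemma thetaV (a : R[i]) : a != 0 -> theta p a^-1 = - theta p a / a.
Proof.
move=> a0; have [->|a1] := eqVneq a 1; first by rewrite invr1 theta_1 oppr0 mul0r.
have part m : theta_part a^-1 m * ((1 - a) * (1 - p ^+ m / a))
   = theta_part a m * ((1 - a^-1) * (1 - a * p ^+ m)).
  elim: m => [|m IH]; first by rewrite /theta_part !big_nil expr0; field.
  rewrite /theta_part !big_nat_recr //= -!/(theta_part _ _) invrK.
  transitivity (theta_part a^-1 m * ((1 - a) * (1 - p ^+ m / a)) *
      ((1 - p ^+ m.+1 * a) * (1 - p ^+ m.+1 / a))); first by ring.
  by rewrite IH; ring.
have lim1 : ((fun m => theta_part a^-1 m * ((1 - a) * (1 - p ^+ m / a))) : nat -> C) @ \oo -->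
   (theta p a^-1 * ((1 - a) * (1 - 0 / a)) : C).
  apply: cvgCM; first exact: theta_cvg.
  apply: cvgCM; first exact: cvgC_cst.
  apply: cvgB; first exact: cvgC_cst.
  by apply: cvgCM; [exact: cvg_pX | exact: cvgC_cst].
have lim2 : ((fun m => theta_part a^-1 m * ((1 - a) * (1 - p ^+ m / a))) : nat -> C) @ \oo -->
   (theta p a * ((1 - a^-1) * (1 - a * 0)) : C).
  under eq_fun do rewrite part.
  apply: cvgCM; first exact: theta_cvg.
  apply: cvgCM; first exact: cvgC_cst.
  apply: cvgB; first exact: cvgC_cst.
  by apply: cvgCM; [exact: cvgC_cst | exact: cvg_pX].
have := cvgC_unique lim1 lim2.
rewrite mul0r mulr0 !subr0 !mulr1 => e.
have a1' : 1 - a != 0 by rewrite subr_eq0 eq_sym.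
apply: (mulIf a1'); rewrite e //.
by field.
Qed.

(** The moduli of the zeros of theta are powers of |p|, and the ratio of two
    such powers is not strictly between 1 and 1 / |p|. *)
Lemma theta_zero_ratio (u : R[i]) (s t : R) : u != 0 -> 0 < s -> s < t ->
  t * normc p < s -> theta p (u * s%:C) = 0 -> theta p (u * t%:C) = 0 -> False.
Proof.
move=> u0 s0 st tps; set rho := normc p in tps *.
have rho0 : 0 <= rho by exact: normc_ge0.
have key (x : R) : 0 < x -> theta p (u * x%:C) = 0 ->
    exists ij : nat * nat, normc u * x * rho ^+ ij.1 = rho ^+ ij.2 /\ 0 < rho ^+ ij.2.
  move=> x0 /theta_eq0 [j hj].
  have nx : normc (u * x%:C) = normc u * x.
    by rewrite normcM /= expr0n /= addr0 sqrtr_sqr gtr0_norm.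
  have ux0 : 0 < normc u * x by rewrite mulr_gt0 // normc_gt0.
  case: hj => /(congr1 (@normc R)).
    rewrite normcM nx normcX normc1 => h; exists (j, 0%N) => /=.
    by rewrite expr0 h.
  rewrite normcM normcX normcV nx normc1 => h; exists (0%N, j.+1) => /=.
  have e : rho ^+ j.+1 = normc u * x by rewrite -[RHS]mul1r -h mulfVK ?gt_eqF.
  by rewrite expr0 mulr1 e.
move=> /key - /(_ s0) [[j i] /= [hs hi]] /key - /(_ (lt_trans s0 st)) [[j' i'] /= [ht hi']].
have u0' := normc_gt0 u0.
have e : s * rho ^+ (j + i') = t * rho ^+ (j' + i).
  apply: (mulfI (lt0r_neq0 u0')); rewrite !exprD.
  transitivity (normc u * s * rho ^+ j * rho ^+ i'); first by ring.
  by rewrite hs -ht; ring.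
have ri' : 0 < rho ^+ (j + i').
  rewrite exprD mulr_gt0 // lt_neqAle exprn_ge0 // andbT eq_sym.
  by apply: contraTneq hi => h; rewrite -hs h mulr0 ltxx.
have rj' : 0 < rho ^+ (j' + i).
  by have := mulr_gt0 s0 ri'; rewrite e pmulr_rgt0 // (lt_trans s0).
have [hle|hlt] := leqP (j' + i) (j + i').
  have : rho ^+ (j + i') <= rho ^+ (j' + i) by rewrite ler_wiXn2l // ltW.
  by nra.
have : rho ^+ (j' + i) <= rho ^+ (j + i').+1 by rewrite ler_wiXn2l // ltW.
rewrite exprS; have t0 := lt_trans s0 st.
by rewrite -(ler_pM2l t0) -e mulrA leNgt ltr_pM2r // tps.
Qed.

(** On a short enough segment each dilated theta function has at most one zero;
    the functions are treated one after the other, by passing to one side of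
    the zero. *)
Let theta_nonzero_interval (us : seq R[i]) (hi : R) : 1 < hi -> hi * normc p < 1 ->
  all (fun u => u != 0) us ->
  exists s t : R, [/\ 1 < s, s < t, t < hi &
    forall x, s < x -> x < t -> all (fun u => theta p (u * x%:C) != 0) us].
Proof.
move=> hi1 hip; elim: us => [_|u us IH /= /andP[u0 /IH [s [t [s1 st thi good]]]]].
  by exists ((2 + hi) / 3), ((1 + 2 * hi) / 3); split; [lra..|].
have [[y [sy yt hy]]|hne] := pselect (exists y, [/\ s < y, y < t & theta p (u * y%:C) = 0]).
  exists s, y; split=> //; first exact: lt_trans yt thi.
  move=> x sx xy; rewrite good ?(lt_trans xy) // andbT; apply/eqP => hx.
  apply: (theta_zero_ratio u0 _ xy _ hx hy); first by lra.
  apply: lt_trans (_ : 1 < x); last by lra.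
  apply: le_lt_trans hip; rewrite ler_wpM2r ?normc_ge0 //.
  by rewrite ltW // (lt_trans yt).
exists s, t; split=> // x sx xt; rewrite good // andbT.
by apply/eqP => hx; apply: hne; exists x.
Qed.

(** The source of points in general position for the interpolation. *)
Lemma theta_avoid (us : seq R[i]) : all (fun u => u != 0) us ->
  exists2 t, t != 0 & all (fun u => theta p (u * t) != 0) us.
Proof.
have [hi [hi1 hip]] : exists hi, 1 < hi /\ hi * normc p < 1.
  have p0 := normc_ge0 p; exists (2 / (1 + normc p)).
  have h : 0 < 1 + normc p by lra.
  split; first by rewrite ltr_pdivlMr // mul1r -[2]/(1 + 1) ltrD2l.
  by rewrite mulrAC ltr_pdivrMr // mul1r -[2]/(1 + 1) mulrDl !mul1r ltrD2r.
move=> /(theta_nonzero_interval hi1 hip) [s [t [s1 st _ good]]].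
exists (((s + t) / 2)%:C); last by apply: good; lra.
by apply/eqP => /(congr1 (@complex.Re R)) /= h; lra.
Qed.

End ThetaBasics.

(** * Coefficient norms of polynomials *)

Section CoefficientNorm.
Variable R : realType.

(** Its values at a given radius r >= 0 form a submultiplicative norm. *)
Definition abs_poly (P : {poly R[i]}) : {poly R} := \poly_(k < size P) normc P`_k.

Lemma coef_abs_poly P k : (abs_poly P)`_k = normc P`_k.
Proof.
rewrite coef_poly; case: ltnP => // h; by rewrite nth_default // normc0.
Qed.

Lemma horner_le (A B : {poly R}) (r : R) : 0 <= r ->
  (forall k, A`_k <= B`_k) -> A.[r] <= B.[r].
Proof.
move=> r0 h; set n := maxn (size A) (size B).
rewrite (@horner_coef_wide _ n A) ?leq_maxl // (@horner_coef_wide _ n B) ?leq_maxr //.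
by apply: ler_sum => k _; rewrite ler_wpM2r ?exprn_ge0.
Qed.

Lemma abs_polyM_le (P Q : {poly R[i]}) (r : R) : 0 <= r ->
  (abs_poly (P * Q)).[r] <= (abs_poly P).[r] * (abs_poly Q).[r].
Proof.
move=> r0; rewrite -hornerM; apply: horner_le => // k.
rewrite coef_abs_poly !coefM; apply: le_trans (normc_sum _ _ _) _.
by apply: ler_sum => i _; rewrite normcM !coef_abs_poly.
Qed.

Lemma abs_polyD_le (P Q : {poly R[i]}) (r : R) : 0 <= r ->
  (abs_poly (P + Q)).[r] <= (abs_poly P).[r] + (abs_poly Q).[r].
Proof.
move=> r0; rewrite -hornerD; apply: horner_le => // k.
by rewrite coefD !coef_abs_poly coefD; exact: le_normcD.
Qed.

Lemma abs_polyC (c : R[i]) (r : R) : (abs_poly c%:P).[r] = normc c.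
Proof.
have -> : abs_poly c%:P = (normc c)%:P.
  by apply/polyP => k; rewrite coef_abs_poly !coefC; case: eqP; rewrite ?normc0.
by rewrite hornerC.
Qed.

Lemma abs_polyX (r : R) : (abs_poly 'X).[r] = r.
Proof.
have -> : abs_poly 'X = 'X.
  apply/polyP => k; rewrite coef_abs_poly !coefX.
  by case: eqP => _; rewrite ?normc0 ?normc1.
by rewrite hornerX.
Qed.

Lemma abs_poly_1subX (c : R[i]) (r : R) : 0 <= r ->
  (abs_poly (1 - c%:P * 'X)).[r] <= 1 + normc c * r.
Proof.
move=> r0; apply: le_trans (abs_polyD_le _ _ r0) _.
rewrite -(polyC1) abs_polyC normc1 lerD2l -mulNr -polyCN.
by apply: le_trans (abs_polyM_le _ _ r0) _; rewrite abs_polyC abs_polyX normcN.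
Qed.

Lemma abs_poly_XsubC (c : R[i]) (r : R) : 0 <= r ->
  (abs_poly ('X - c%:P)).[r] <= r + normc c.
Proof.
move=> r0; apply: le_trans (abs_polyD_le _ _ r0) _.
by rewrite -polyCN abs_polyC abs_polyX normcN.
Qed.

Lemma abs_poly_horner_ge0 (P : {poly R[i]}) (r : R) : 0 <= r -> 0 <= (abs_poly P).[r].
Proof.
move=> r0; rewrite -[0](horner0 r); apply: horner_le => // k.
by rewrite coef0 coef_abs_poly normc_ge0.
Qed.

Lemma coef_le_abs_poly (P : {poly R[i]}) k : normc P`_k <= (abs_poly P).[1].
Proof.
rewrite (@horner_coef_wide _ (maxn (size (abs_poly P)) k.+1)) ?leq_maxl //.
have hk : (k < maxn (size (abs_poly P)) k.+1)%N by rewrite leq_maxr.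
rewrite (bigD1 (Ordinal hk)) //= coef_abs_poly expr1n mulr1 lerDl.
by apply: sumr_ge0 => i _; rewrite coef_abs_poly expr1n mulr1 normc_ge0.
Qed.

Lemma coef_comp_scaleX (P : {poly R[i]}) (c : R[i]) k :
  (P \Po (c%:P * 'X))`_k = c ^+ k * P`_k.
Proof.
have -> : P \Po (c%:P * 'X) = \poly_(i < size P) (c ^+ i * P`_i).
  rewrite comp_polyE poly_def; apply: eq_bigr => i _.
  by rewrite exprMn -polyC_exp mul_polyC scalerA mulrC.
rewrite coef_poly; case: ltnP => // h; by rewrite [P`_k]nth_default // mulr0.
Qed.

(** Terms of index k < N - M gain a factor 2^-M when the radius r = |x| is
    replaced by r / 2, those with k > N + M when it is replaced by 2 r. *)
Lemma horner_window (P : {poly R[i]}) (x : R[i]) (M N : nat) : (M <= N)%N ->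
  normc (P.[x] - \sum_(i < M.*2.+1) P`_(N - M + i) * x ^+ (N - M + i)) <=
  2^-1 ^+ M * (2 ^+ N * (abs_poly P).[normc x / 2]
               + 2^-1 ^+ N * (abs_poly P).[2 * normc x]).
Proof.
move=> MN; set s := normc x; have s0 : 0 <= s by exact: normc_ge0.
set n := (size P + (N + M).+1)%N.
have nP : (size P <= n)%N by rewrite leq_addr.
have nA : (size (abs_poly P) <= n)%N by apply: leq_trans nP; exact: size_poly.
have P2 j : 0 <= (2 : R) ^+ j by rewrite exprn_ge0 ?invr_ge0.
have I2 j : 0 <= (2^-1 : R) ^+ j by rewrite exprn_ge0 ?invr_ge0.
have hs : 0 <= s / 2 by rewrite divr_ge0.
have ds : 0 <= 2 * s by rewrite mulr_ge0.
pose T k := normc P`_k * (2 ^+ N * (s / 2) ^+ k + 2^-1 ^+ N * (2 * s) ^+ k).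
have T0 k : 0 <= T k.
  by rewrite mulr_ge0 ?normc_ge0 // addr_ge0 // mulr_ge0 ?(exprn_ge0 k).
have -> : 2 ^+ N * (abs_poly P).[s / 2] + 2^-1 ^+ N * (abs_poly P).[2 * s]
    = \sum_(0 <= k < n) T k.
  rewrite !(horner_coef_wide _ nA) !mulr_sumr -big_split /= big_mkord.
  by apply: eq_bigr => k _; rewrite coef_abs_poly /T; ring.
rewrite (horner_coef_wide _ nP) -(big_mkord xpredT (fun k => P`_k * x ^+ k)).
have le1 : (N - M <= n)%N by rewrite /n; lia.
have le2 : (N - M <= (N + M).+1)%N by lia.
have le3 : ((N + M).+1 <= n)%N by rewrite /n leq_addl.
rewrite (@big_cat_nat _ _ _ (N - M)) //= (@big_cat_nat _ _ _ (N + M).+1 (N - M)) //=.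
rewrite (@big_cat_nat _ _ _ (N - M) 0 n) //= (@big_cat_nat _ _ _ (N + M).+1 (N - M) n) //=.
have -> : \sum_(i < M.*2.+1) P`_(N - M + i) * x ^+ (N - M + i) =
    \sum_(N - M <= k < (N + M).+1) P`_k * x ^+ k.
  rewrite -[X in \sum_(X <= _ < _) _]add0n big_addn.
  have -> : ((N + M).+1 - (N - M) = M.*2.+1)%N by lia.
  by rewrite big_mkord; apply: eq_bigr => k _; rewrite addnC.
set S1 := \sum_(0 <= i < _) P`_i * _; set S2 := \sum_(N - M <= k < _) P`_k * _.
set S3 := \sum_(_ <= i < n) P`_i * _.
have -> : S1 + (S2 + S3) - S2 = S1 + S3 by ring.
rewrite {}/S1 {}/S2 {}/S3.
apply: le_trans (le_normcD _ _) _; rewrite mulrDr.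
have i2 j : (2^-1 : R) ^+ j * 2 ^+ j = 1 by rewrite -exprMn mulVf ?expr1n ?pnatr_eq0.
apply: lerD.
  apply: le_trans (normc_sum _ _ _) _; rewrite mulr_sumr.
  rewrite big_nat [leRHS]big_nat; apply: ler_sum => k /andP[_ hk].
  rewrite normcM normcX /T mulrCA ler_wpM2l ?normc_ge0 //.
  have -> : (N = k + M + (N - M - k))%N by lia.
  apply: le_trans (_ : 2^-1 ^+ M * (2 ^+ (k + M + (N - M - k)) * (s / 2) ^+ k) <= _).
    rewrite !exprD exprMn.
    have -> : 2^-1 ^+ M * (2 ^+ k * 2 ^+ M * 2 ^+ (N - M - k) * (s ^+ k * 2^-1 ^+ k)) =
      (2^-1 ^+ M * 2 ^+ M) * (2^-1 ^+ k * 2 ^+ k) * (2 ^+ (N - M - k) * s ^+ k) :> R by ring.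
    rewrite !i2 !mul1r ler_peMl ?exprn_ge0 //; apply: exprn_ege1; lra.
  by rewrite ler_wpM2l // lerDl mulr_ge0 // exprn_ge0 // mulr_ge0.
apply: (@le_trans _ _ (2^-1 ^+ M * \sum_((N + M).+1 <= k < n) T k)); last first.
  by rewrite ler_wpM2l // lerDr sumr_ge0.
apply: le_trans (normc_sum _ _ _) _; rewrite mulr_sumr.
rewrite big_nat [leRHS]big_nat; apply: ler_sum => k /andP[hk _].
rewrite normcM normcX /T mulrCA ler_wpM2l ?normc_ge0 //.
apply: le_trans (_ : 2^-1 ^+ M * (2^-1 ^+ N * (2 * s) ^+ k) <= _); last first.
  by rewrite ler_wpM2l // lerDr mulr_ge0 // exprn_ge0 // divr_ge0.
have ek : (k = M + N + (k - (M + N)))%N by lia.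
set j := (k - _)%N in ek; rewrite exprMn mulrA mulrA ler_peMl ?exprn_ge0 //.
rewrite ek !exprD.
have -> : 2^-1 ^+ M * 2^-1 ^+ N * (2 ^+ M * 2 ^+ N * 2 ^+ j) =
  (2^-1 ^+ M * 2 ^+ M) * (2^-1 ^+ N * 2 ^+ N) * 2 ^+ j :> R by ring.
by rewrite !i2 !mul1r; apply: exprn_ege1; lra.
Qed.
End CoefficientNorm.

(** * The product theta (x y) theta (x / y) *)

Section ThetaProduct.
Local Open Scope classical_set_scope.
Variables (R : realType) (p : R[i]).
Local Notation C := (R[i] : numFieldType).
Hypotheses (hp : normc p < 1) (p0 : p != 0).

(** Truncation of theta (x y) * theta (x / y), as a polynomial in x after
    multiplication by a power of x. *)
Definition pair_poly (y : R[i]) (m : nat) : {poly R[i]} :=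
  \prod_(0 <= j < m)
    ((1 - (y * p ^+ j)%:P * 'X) * (1 - (p ^+ j / y)%:P * 'X) *
     (('X - (p ^+ j.+1 * y)%:P) * ('X - (p ^+ j.+1 / y)%:P))).

Definition pair_part (y x : R[i]) (m : nat) : R[i] :=
  theta_part p (x * y) m * theta_part p (x / y) m.

Lemma pair_polyS (y : R[i]) m : pair_poly y m.+1 = pair_poly y m *
    ((1 - (y * p ^+ m)%:P * 'X) * (1 - (p ^+ m / y)%:P * 'X) *
     (('X - (p ^+ m.+1 * y)%:P) * ('X - (p ^+ m.+1 / y)%:P))).
Proof. by rewrite /pair_poly big_nat_recr. Qed.

Lemma pair_polyE (y x : R[i]) m : y != 0 -> x != 0 ->
  (pair_poly y m).[x] = pair_part y x m * x ^+ m.*2.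
Proof.
move=> y0 x0; elim: m => [|m IH].
  by rewrite /pair_part /theta_part /pair_poly !big_nil hornerC expr0 !mulr1.
have -> : pair_part y x m.+1 = pair_part y x m *
   ((1 - x * y * p ^+ m) * (1 - p ^+ m.+1 / (x * y)) *
   ((1 - x / y * p ^+ m) * (1 - p ^+ m.+1 / (x / y)))).
  by rewrite /pair_part /theta_part !big_nat_recr //=; ring.
have -> : x ^+ m.+1.*2 = x ^+ m.*2 * x ^+ 2 by rewrite doubleS -addn2 exprD.
rewrite pair_polyS hornerM IH !(hornerM, hornerD, hornerN, hornerX, hornerC).
by field; rewrite x0 y0.
Qed.

(** The quasi-periodicity G (p x) = x^-2 G (x) of the function
    G (x) = theta (x y) * theta (x / y), with the correction by the boundary
    factors of the truncation, which telescope. *)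
Lemma pair_poly_dilation (y : R[i]) m : y != 0 ->
  (('X - (p ^+ m * y)%:P) * ('X - (p ^+ m / y)%:P)) * (pair_poly y m \Po (p%:P * 'X)) =
  (p ^+ m.*2)%:P * ((1 - (y * p ^+ m)%:P * 'X) * (1 - (p ^+ m / y)%:P * 'X)) * pair_poly y m.
Proof.
move=> y0.
have nz : (('X - y%:P) * ('X - (y^-1)%:P) : {poly R[i]}) != 0.
  by rewrite mulf_neq0 // polyXsubC_eq0.
apply: (mulIf nz).
have yy : y%:P * (y^-1)%:P = 1 :> {poly R[i]} by rewrite -polyCM divff.
have e1 : ('X - y%:P) * ('X - (y^-1)%:P) = (1 - y%:P * 'X) * (1 - (y^-1)%:P * 'X) :> {poly R[i]}.
  transitivity ('X ^+ 2 - (y%:P + (y^-1)%:P) * 'X + y%:P * (y^-1)%:P : {poly R[i]}); first by ring.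
  transitivity (1 - (y%:P + (y^-1)%:P) * 'X + y%:P * (y^-1)%:P * 'X ^+ 2 : {poly R[i]}); last by ring.
  by rewrite yy; ring.
elim: m => [|m IH].
  by rewrite /pair_poly !big_nil comp_polyC !expr0 !mul1r !mulr1 -e1 ?polyC1 ?mul1r.
rewrite !pair_polyS comp_polyM.
set L := pair_poly y m \Po _ in IH *; set H := pair_poly y m in IH *.
have -> : ((1 - (y * p ^+ m)%:P * 'X) * (1 - (p ^+ m / y)%:P * 'X) *
     (('X - (p ^+ m.+1 * y)%:P) * ('X - (p ^+ m.+1 / y)%:P))) \Po (p%:P * 'X) =
   (1 - (y * p ^+ m.+1)%:P * 'X) * (1 - (p ^+ m.+1 / y)%:P * 'X) * (p ^+ 2)%:P *
     (('X - (p ^+ m * y)%:P) * ('X - (p ^+ m / y)%:P)).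
  rewrite !(comp_polyM, comp_polyB, comp_polyC, comp_polyX).
  by rewrite !exprS !polyCM; ring.
transitivity ((1 - (y * p ^+ m.+1)%:P * 'X) * (1 - (p ^+ m.+1 / y)%:P * 'X) * (p ^+ 2)%:P *
     (('X - (p ^+ m.+1 * y)%:P) * ('X - (p ^+ m.+1 / y)%:P)) *
   (('X - (p ^+ m * y)%:P) * ('X - (p ^+ m / y)%:P) * L * (('X - y%:P) * ('X - (y^-1)%:P)))).
  by ring.
have -> : (p ^+ m.+1.*2)%:P = (p ^+ m.*2)%:P * (p ^+ 2)%:P :> {poly R[i]}.
  by rewrite doubleS -addn2 exprD polyCM.
rewrite IH; set P2 := (p ^+ 2)%:P; set PM := (p ^+ m.*2)%:P.
set A1 := (_ * p ^+ m.+1)%:P; set A2 := (p ^+ m.+1 / y)%:P; set A3 := (p ^+ m.+1 * y)%:P.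
set A4 := (y * p ^+ m)%:P; set A5 := (p ^+ m / y)%:P; set A6 := (y^-1)%:P.
by ring.
Qed.

(** Comparison of coefficients in the dilation formula: up to terms of order
    p ^ m, the coefficients satisfy a two-term recurrence that does not
    involve y. *)
Lemma pair_poly_coef (y : R[i]) m k : y != 0 ->
  p ^+ k * (pair_poly y m)`_k
    - p ^+ m * (y + y^-1) * (p ^+ k.+1 * (pair_poly y m)`_k.+1)
    + p ^+ m.*2 * (p ^+ k.+2 * (pair_poly y m)`_k.+2) =
  p ^+ m.*2 * ((pair_poly y m)`_k.+2
    - p ^+ m * (y + y^-1) * (pair_poly y m)`_k.+1 + p ^+ m.*2 * (pair_poly y m)`_k).
Proof.
move=> y0; have := pair_poly_dilation m y0.
have yy : y%:P * (y^-1)%:P = 1 :> {poly R[i]} by rewrite -polyCM divff.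
set w := p ^+ m * (y + y^-1).
have mm : (p ^+ m)%:P * (p ^+ m)%:P = (p ^+ m.*2)%:P :> {poly R[i]}.
  by rewrite -polyCM -exprD addnn.
have -> : ('X - (p ^+ m * y)%:P) * ('X - (p ^+ m / y)%:P) =
   'X^2 - w%:P * 'X + (p ^+ m.*2)%:P :> {poly R[i]}.
  rewrite /w -mm !polyCM polyCD.
  transitivity ('X ^+ 2 - (p ^+ m)%:P * (y%:P + (y^-1)%:P) * 'X
     + (y%:P * (y^-1)%:P) * ((p ^+ m)%:P * (p ^+ m)%:P) : {poly R[i]}); first by ring.
  by rewrite yy mul1r.
have -> : (1 - (y * p ^+ m)%:P * 'X) * (1 - (p ^+ m / y)%:P * 'X) =
   1 - w%:P * 'X + (p ^+ m.*2)%:P * 'X^2 :> {poly R[i]}.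
  rewrite /w -mm !polyCM polyCD.
  transitivity (1 - (p ^+ m)%:P * (y%:P + (y^-1)%:P) * 'X
     + (y%:P * (y^-1)%:P) * ((p ^+ m)%:P * (p ^+ m)%:P) * 'X^2 : {poly R[i]}); first by ring.
  by rewrite yy mul1r.
move=> /(congr1 (fun P : {poly R[i]} => P`_k.+2)).
move=> h; rewrite -mulrA [in LHS]mulrDl [in LHS]mulrBl [in RHS]mulrDl [in RHS]mulrBl mul1r in h.
by rewrite -!mulrA !(coefD, coefN, coefCM, coefXnM, coefXM) /= !coef_comp_scaleX in h.
Qed.

(** Apart from the power of r, which is removed by the passage to Laurent
    polynomials, the bound does not depend on m. *)
Lemma abs_pair_poly_le (y : R[i]) (r : R) m : 0 < r ->
  (abs_poly (pair_poly y m)).[r] <= r ^+ m.*2 *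
    (expR (normc y * r / (1 - normc p)) * expR (normc y^-1 * r / (1 - normc p)) *
     (expR (normc p * normc y / r / (1 - normc p)) *
      expR (normc p * normc y^-1 / r / (1 - normc p)))).
Proof.
move=> r0; have rr := ltW r0; set q := normc p.
have q0 : 0 <= q by exact: normc_ge0.
have y0 : 0 <= normc y by exact: normc_ge0. 
have y1 : 0 <= normc y^-1 by exact: normc_ge0.
set a := normc y * r; set b := normc y^-1 * r.
set c := normc p * normc y / r; set d := normc p * normc y^-1 / r.
have a0 : 0 <= a by rewrite mulr_ge0.
have b0 : 0 <= b by rewrite mulr_ge0.
have c0 : 0 <= c by rewrite divr_ge0 ?mulr_ge0.
have d0 : 0 <= d by rewrite divr_ge0 ?mulr_ge0.
pose G (u : R) := \prod_(0 <= j < m) (1 + u * q ^+ j).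
have G0 u : 0 <= u -> 0 <= G u.
  by move=> u0; apply: prodr_ge0 => j _; rewrite addr_ge0 ?mulr_ge0 ?exprn_ge0.
apply: (@le_trans _ _ (r ^+ m.*2 * (G a * G b * (G c * G d)))); last first.
  rewrite ler_wpM2l ?exprn_ge0 //.
  by rewrite ler_pM ?ler_pM ?mulr_ge0 ?G0 ?prod_geometric_le.
have -> : r ^+ m.*2 * (G a * G b * (G c * G d)) =
   \prod_(0 <= j < m) ((1 + a * q ^+ j) * (1 + b * q ^+ j) *
      ((r + q ^+ j.+1 * normc y) * (r + q ^+ j.+1 * normc y^-1))).
  rewrite /G; elim: (m) => [|k IH]; first by rewrite !big_nil !mulr1.
  rewrite !big_nat_recr // -IH doubleS !exprS /c /d -/q /=.
  by field; rewrite gt_eqF.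
rewrite /pair_poly; elim: (m) => [|k IH].
  by rewrite !big_nil -polyC1 abs_polyC normc1.
rewrite !big_nat_recr //=; apply: le_trans (abs_polyM_le _ _ rr) _.
apply: ler_pM; rewrite ?abs_poly_horner_ge0 //.
apply: le_trans (abs_polyM_le _ _ rr) _.
apply: ler_pM; rewrite ?abs_poly_horner_ge0 //.
  apply: le_trans (abs_polyM_le _ _ rr) _.
  apply: ler_pM; rewrite ?abs_poly_horner_ge0 //.
    apply: le_trans (abs_poly_1subX _ rr) _; rewrite normcM normcX /a -/q.
    by rewrite lerD2l mulrAC.
  apply: le_trans (abs_poly_1subX _ rr) _; rewrite normcM normcX /b -/q.
  by rewrite lerD2l -mulrA mulrC.
apply: le_trans (abs_polyM_le _ _ rr) _.
apply: ler_pM; rewrite ?abs_poly_horner_ge0 //.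
  by apply: le_trans (abs_poly_XsubC _ rr) _; rewrite normcM normcX.
by apply: le_trans (abs_poly_XsubC _ rr) _; rewrite normcM normcX.
Qed.
End ThetaProduct.

Section ThetaAddition.
Local Open Scope classical_set_scope.
Variables (R : realType) (p : R[i]).
Local Notation C := (R[i] : numFieldType).
Hypotheses (hp : normc p < 1) (p0 : p != 0).

(** The Laurent coefficients of theta (x y) * theta (x / y) satisfy
    g_(k + 2) = p ^ k g_k; here the index k is i - M. *)
Definition coef_ratio (M i : nat) : R[i] := p ^+ i / p ^+ M.

Fixpoint two_step (f : nat -> R[i]) (u v : R[i]) (i : nat) : R[i] :=
  match i with
  | 0 => u
  | j.+1 => if j is k.+1 then f k * two_step f u v k else v
  end.

Definition window_fun (M : nat) (u v x : R[i]) : R[i] :=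
  \sum_(i < M.*2.+1) two_step (coef_ratio M) u v i * x ^+ i / x ^+ M.

(** Coefficient of x ^ (i - M) in the truncated product, as a Laurent polynomial
    in x. *)
Definition central_coef (y : R[i]) (M m i : nat) : R[i] := (pair_poly p y m)`_(m.*2 - M + i).

Lemma pair_poly_coef_bound (y : R[i]) : exists2 D : R, 0 <= D &
  forall m k, normc (pair_poly p y m)`_k <= D.
Proof.
exists (expR (normc y * 1 / (1 - normc p)) * expR (normc y^-1 * 1 / (1 - normc p)) *
     (expR (normc p * normc y / 1 / (1 - normc p)) *
      expR (normc p * normc y^-1 / 1 / (1 - normc p)))) => [|m k].
  by rewrite !mulr_ge0 // expR_ge0.
apply: le_trans (coef_le_abs_poly _ _) _.
by apply: le_trans (abs_pair_poly_le hp y m ltr01) _; rewrite expr1n mul1r.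
Qed.

Lemma central_coef_step (y : R[i]) (M i : nat) : y != 0 -> exists2 E : R, 0 <= E &
  forall m, (M <= m)%N ->
  normc (central_coef y M m i.+2 - coef_ratio M i * central_coef y M m i) <= E * normc p ^+ m.
Proof.
move=> y0; have [D D0 hD] := pair_poly_coef_bound y.
set w := y + y^-1.
exists (D * (normc (w * coef_ratio M i.+1) + normc (coef_ratio M i.+2) + normc w + 1)) => [|m Mm].
  by rewrite mulr_ge0 // !addr_ge0 // normc_ge0.
have := pair_poly_coef p m (m.*2 - M + i) y0; rewrite -/w.
have hk j : p ^+ (m.*2 - M + j) = p ^+ m.*2 * coef_ratio M j.
  rewrite /coef_ratio mulrCA -expfB_cond; last by rewrite (negbTE p0) add0n; lia.
  by rewrite -exprD addnC.
rewrite -!addnS !hk -/(central_coef y M m i) -/(central_coef y M m i.+1) -/(central_coef y M m i.+2).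
set h0 := central_coef y M m i; set h1 := central_coef y M m i.+1; set h2 := central_coef y M m i.+2.
set e := p ^+ m; have -> : p ^+ m.*2 = e * e by rewrite /e -exprD addnn.
move=> h; have ee0 : e * e != 0 by rewrite mulf_neq0 // expf_neq0.
have -> : h2 - coef_ratio M i * h0 = e * (- (w * coef_ratio M i.+1) * h1 + e * (coef_ratio M i.+2 * h2)
    + w * h1 - e * h0).
  apply: (mulfI ee0); apply/eqP; rewrite -subr_eq0; apply/eqP.
  have /eqP := h; rewrite -subr_eq0 => /eqP {}h.
  rewrite -[RHS]oppr0 -{}[in RHS]h; ring.
have e1 : normc e <= 1 by rewrite normcX exprn_ile1 ?normc_ge0 // ltW.
rewrite normcM [leRHS]mulrC normcX ler_wpM2l ?exprn_ge0 ?normc_ge0 //.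
have b0 : normc h0 <= D by exact: hD.
have b1 : normc h1 <= D by exact: hD.
have b2 : normc h2 <= D by exact: hD.
have nn := @normc_ge0 R.
apply: le_trans (le_normcD _ _) _; rewrite mulrDr; apply: lerD; last first.
  by rewrite normcN normcM mulr1 -[leRHS]mul1r ler_pM.
apply: le_trans (le_normcD _ _) _; rewrite mulrDr; apply: lerD; last first.
  by rewrite normcM mulrC ler_wpM2r.
apply: le_trans (le_normcD _ _) _; rewrite mulrDr; apply: lerD.
  by rewrite normcM normcN mulrC ler_wpM2r.
rewrite normcM -[leRHS]mul1r ler_pM // normcM mulrC ler_wpM2r //.
Qed.

Lemma central_coef_approx (y : R[i]) (M i : nat) : y != 0 -> exists2 E : R, 0 <= E &
  forall m, (M <= m)%N ->
  normc (central_coef y M m i - (two_step (coef_ratio M) 1 0 i * central_coef y M m 0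
     + two_step (coef_ratio M) 0 1 i * central_coef y M m 1)) <= E * normc p ^+ m.
Proof.
move=> y0; move: i.
pose Q i := exists2 E : R, 0 <= E & forall m, (M <= m)%N ->
  normc (central_coef y M m i - (two_step (coef_ratio M) 1 0 i * central_coef y M m 0
     + two_step (coef_ratio M) 0 1 i * central_coef y M m 1)) <= E * normc p ^+ m.
suff h i : Q i /\ Q i.+1 by move=> i; case: (h i).
elim: i => [|i [IH IH']]; rewrite /Q.
  split; exists 0 => // m _ /=.
    by rewrite mul1r mul0r addr0 subrr normc0 mul0r.
  by rewrite mul1r mul0r add0r subrr normc0 mul0r.
split=> //; case: IH => E E0 hE; have [E' E0' hE'] := central_coef_step M i y0.
exists (E' + normc (coef_ratio M i) * E) => [|m Mm].
  by rewrite addr_ge0 // mulr_ge0 // normc_ge0.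
rewrite /=; set a := two_step _ 1 0 i; set b := two_step _ 0 1 i.
have -> : central_coef y M m i.+2 - (coef_ratio M i * a * central_coef y M m 0
    + coef_ratio M i * b * central_coef y M m 1) =
  (central_coef y M m i.+2 - coef_ratio M i * central_coef y M m i) + coef_ratio M i *
    (central_coef y M m i - (a * central_coef y M m 0 + b * central_coef y M m 1)) by ring.
apply: le_trans (le_normcD _ _) _; rewrite mulrDl; apply: lerD; first exact: hE'.
by rewrite normcM -mulrA ler_wpM2l ?normc_ge0 // hE.
Qed.

(** By the recurrence, the coefficients inside the window of exponents between
    - M and M are determined by the first two of them, up to terms of order p^m;
    the terms outside the window are of order 2^-M by [horner_window]. *)
Lemma pair_part_approx (x y : R[i]) : x != 0 -> y != 0 ->
  exists2 K : R, 0 <= K & forall M, exists2 E : R, 0 <= E & forall m, (M <= m)%N ->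
  normc (pair_part p y x m - (window_fun M 1 0 x * central_coef y M m 0
     + window_fun M 0 1 x * central_coef y M m 1)) <= K * 2^-1 ^+ M + E * normc p ^+ m.
Proof.
move=> x0 y0; set s := normc x; have s0 : 0 < s by exact: normc_gt0.
pose D (r : R) := expR (normc y * r / (1 - normc p)) * expR (normc y^-1 * r / (1 - normc p)) *
     (expR (normc p * normc y / r / (1 - normc p)) *
      expR (normc p * normc y^-1 / r / (1 - normc p))).
have D0 r : 0 <= D r by rewrite !mulr_ge0 // expR_ge0.
exists (D (s / 2) + D (2 * s)) => [|M]; first exact: addr_ge0.
pose err (E : nat -> R) := \sum_(i < M.*2.+1) E i * (s ^+ i / s ^+ M).
have [E hE] := choice (fun i => let: ex_intro2 E E0 h := central_coef_approx M i y0 in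
   ex_intro (fun E : R => 0 <= E /\ forall m, (M <= m)%N ->
     normc (central_coef y M m i - (two_step (coef_ratio M) 1 0 i * central_coef y M m 0
       + two_step (coef_ratio M) 0 1 i * central_coef y M m 1)) <= E * normc p ^+ m) E (conj E0 h)).
exists (err E) => [|m Mm].
  apply: sumr_ge0 => i _; rewrite mulr_ge0 //; first by case: (hE i).
  by rewrite divr_ge0 // exprn_ge0 // ltW.
set c0 := central_coef y M m 0; set c1 := central_coef y M m 1.
(* the terms with exponents between - M and M *)
pose W := \sum_(i < M.*2.+1) (pair_poly p y m)`_(m.*2 - M + i) * x ^+ (m.*2 - M + i).
have xm0 : x ^+ m.*2 != 0 by rewrite expf_neq0.
have M2m : (M <= m.*2)%N by lia.
have eW : W / x ^+ m.*2 = \sum_(i < M.*2.+1) central_coef y M m i * (x ^+ i / x ^+ M).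
  rewrite /W mulr_suml; apply: eq_bigr => i _; rewrite -/(central_coef y M m i) -mulrA.
  congr (_ * _); apply: (mulIf xm0); rewrite mulfVK //.
  rewrite -mulrA [_^-1 * _]mulrC -expfB_cond; last by rewrite (negbTE x0) add0n; lia.
  by rewrite -exprD addnC.
have -> : pair_part p y x m - (window_fun M 1 0 x * c0 + window_fun M 0 1 x * c1) =
   ((pair_poly p y m).[x] - W) / x ^+ m.*2 +
   \sum_(i < M.*2.+1) (central_coef y M m i - (two_step (coef_ratio M) 1 0 i * c0 +
        two_step (coef_ratio M) 0 1 i * c1)) * (x ^+ i / x ^+ M).
  transitivity (pair_part p y x m - W / x ^+ m.*2 +
     (W / x ^+ m.*2 - (window_fun M 1 0 x * c0 + window_fun M 0 1 x * c1))).
    by ring.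
  rewrite pair_polyE // mulrBl mulfK //; congr (_ + _).
  rewrite eW /window_fun !mulr_suml -big_split /= -sumrB.
  by apply: eq_bigr => i _; ring.
apply: le_trans (le_normcD _ _) _; apply: lerD; last first.
  apply: le_trans (normc_sum _ _ _) _; rewrite /err mulr_suml; apply: ler_sum => i _.
  rewrite !normcM normcV !normcX -/s mulrAC ler_wpM2r ?divr_ge0 ?exprn_ge0 ?(ltW s0) //.
  by case: (hE i) => _; apply.
rewrite normcM normcV normcX -/s ler_pdivrMr ?exprn_gt0 //.
have hs : 0 < s / 2 by rewrite divr_gt0.
have ds : 0 < 2 * s by rewrite mulr_gt0.
apply: le_trans (horner_window _ _ M2m) _; rewrite -/s.
have -> : (D (s / 2) + D (2 * s)) * 2^-1 ^+ M * s ^+ m.*2 =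
  2^-1 ^+ M * (s ^+ m.*2 * (D (s / 2) + D (2 * s))) by ring.
rewrite ler_wpM2l ?exprn_ge0 ?invr_ge0 //.
have i2 j : (2^-1 : R) ^+ j * 2 ^+ j = 1 by rewrite -exprMn mulVf ?expr1n ?pnatr_eq0.
have i2' j : (2 : R) ^+ j * 2^-1 ^+ j = 1 by rewrite mulrC i2.
rewrite mulrDr; apply: lerD.
  apply: le_trans (_ : 2 ^+ m.*2 * ((s / 2) ^+ m.*2 * D (s / 2)) <= _).
    by rewrite ler_wpM2l ?exprn_ge0 //; exact: abs_pair_poly_le.
  have -> : 2 ^+ m.*2 * ((s / 2) ^+ m.*2 * D (s / 2)) =
    2 ^+ m.*2 * 2^-1 ^+ m.*2 * (s ^+ m.*2 * D (s / 2)) by rewrite exprMn; ring.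
  by rewrite i2' mul1r.
apply: le_trans (_ : 2^-1 ^+ m.*2 * ((2 * s) ^+ m.*2 * D (2 * s)) <= _).
  by rewrite ler_wpM2l ?exprn_ge0 ?invr_ge0 //; exact: abs_pair_poly_le.
have -> : 2^-1 ^+ m.*2 * ((2 * s) ^+ m.*2 * D (2 * s)) =
  2^-1 ^+ m.*2 * 2 ^+ m.*2 * (s ^+ m.*2 * D (2 * s)) by rewrite exprMn; ring.
by rewrite i2 mul1r.
Qed.
End ThetaAddition.

(** * The three-term relation *)

Definition det3 (F : comPzRingType) (A : 'I_3 -> 'I_3 -> F) : F :=
  A 0 0 * (A 1 1 * A 2 2 - A 1 2 * A 2 1)
  - A 0 1 * (A 1 0 * A 2 2 - A 1 2 * A 2 0)
  + A 0 2 * (A 1 0 * A 2 1 - A 1 1 * A 2 0).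

Lemma det3_rank2 (F : comPzRingType) (u v s t : 'I_3 -> F) :
  det3 (fun i j => u i * s j + v i * t j) = 0.
Proof. by rewrite /det3; ring. Qed.

Section ThetaWeierstrass.
Local Open Scope classical_set_scope.
Variables (R : realType) (p : R[i]).
Local Notation C := (R[i] : numFieldType).
Hypotheses (hp : normc p < 1).

Definition theta_pair (x y : R[i]) : R[i] := theta p (x * y) * theta p (x / y).

Lemma pair_part_cvg (x y : R[i]) : (pair_part p y x : nat -> C) @ \oo --> (theta_pair x y : C).
Proof. by apply: cvgCM; exact: theta_cvg. Qed.

(** The matrix is a limit of matrices of rank two. *)
Lemma theta_pair_det (x y : 'I_3 -> R[i]) : p != 0 ->
  (forall i, x i != 0) -> (forall i, y i != 0) ->
  det3 (fun i j => theta_pair (x i) (y j)) = 0.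
Proof.
move=> p0 x0 y0.
have [L [hL hdet]] : exists L : nat -> 'I_3 -> 'I_3 -> R[i],
    (forall i j, ((fun M => L M i j) : nat -> C) @ \oo --> (theta_pair (x i) (y j) : C)) /\
    forall M, det3 (L M) = 0.
  pose K i j := projT1 (cid2 (pair_part_approx hp p0 (x0 i) (y0 j))).
  pose Lm M m i j := window_fun p M 1 0 (x i) * central_coef p (y j) M m 0
     + window_fun p M 0 1 (x i) * central_coef p (y j) M m 1.
  (* the order m of truncation is chosen once the window M is fixed *)
  have hm M : exists m, (M <= m)%N /\ forall i j,
      normc (pair_part p (y j) (x i) m - Lm M m i j) <= (K i j + 1) * 2^-1 ^+ M.
    have : \forall m \near \oo, forall ij : 'I_3 * 'I_3,
      normc (pair_part p (y ij.2) (x ij.1) m - Lm M m ij.1 ij.2) <= (K ij.1 ij.2 + 1) * 2^-1 ^+ M.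
      apply: filter_forall => -[i j] /=.
      rewrite /K; case: (cid2 _) => k k0 /= /(_ M) [E E0 hE].
      have : (fun m => E * normc p ^+ m) @ \oo --> (0 : R).
        by apply: cvg_geometric; rewrite ger0_norm ?normc_ge0.
      move=> /cvgrPdist_le /(_ (2^-1 ^+ M)); case; first by rewrite exprn_gt0 ?invr_gt0.
      move=> N _ hN; exists (maxn M N) => // m /=; rewrite geq_max => /andP[Mm Nm].
      apply: le_trans (hE m Mm) _; rewrite mulrDl mul1r lerD2l.
      have := hN m Nm; rewrite /= sub0r normrN; exact: le_trans (ler_norm _).
    case=> N _ hN; exists (maxn M N); split; first exact: leq_maxl.
    by move=> i j; apply: (hN (maxn M N) (leq_maxr _ _) (i, j)).
  have [m hm'] := choice hm.
  exists (fun M => Lm M (m M)); split=> [i j|M]; last first.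
    exact: det3_rank2.
  apply/cvg_normcP.
  have /cvg_normcP h1 := @pair_part_cvg (x i) (y j).
  have h2 : (fun M => (K i j + 1) * 2^-1 ^+ M
      + normc (pair_part p (y j) (x i) (m M) - theta_pair (x i) (y j))) @ \oo --> (0 : R).
    rewrite -[0]addr0; apply: cvgD.
      by apply: cvg_geometric; rewrite ger0_norm ?invr_ge0 // invf_lt1 // ltr1n.
    move/cvgrPdist_lt : h1 => h1; apply/cvgrPdist_lt => e /h1 [N _ hN].
    exists N => // M /= NM; apply: hN => /=; exact: leq_trans NM (hm' M).1.
  apply: squeeze_cvgr (cvg_cst 0) h2; near=> M; rewrite normc_ge0 /=.
  have h3 := (hm' M).2 i j.
  apply: le_trans (_ : normc (- (pair_part p (y j) (x i) (m M) - Lm M (m M) i j)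
     + (pair_part p (y j) (x i) (m M) - theta_pair (x i) (y j))) <= _).
    by rewrite le_eqVlt; apply/orP; left; apply/eqP; congr normc; ring.
  by apply: le_trans (le_normcD _ _) _; rewrite normcN lerD2r.
have : ((fun M => det3 (L M)) : nat -> C) @ \oo -->
    (det3 (fun i j => theta_pair (x i) (y j)) : C).
  by rewrite /det3; apply: cvgCD; [apply: cvgCB|];
    (apply: cvgCM; [exact: hL | apply: cvgCB; apply: cvgCM; exact: hL]).
under eq_fun do rewrite hdet.
by move=> h; exact: (@cvgC_unique R (fun=> 0) _ _ h (@cvgC_cst R 0)).
Unshelve. all: by end_near.
Qed.

Lemma theta_pairC (x y : R[i]) : x != 0 -> y != 0 ->
  theta_pair y x = - (y / x) * theta_pair x y.
Proof.
move=> x0 y0; rewrite /theta_pair mulrC.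
have -> : y / x = (x / y)^-1 by rewrite invf_div.
rewrite (thetaV hp) ?mulf_neq0 ?invr_neq0 // [y * x]mulrC.
by field; rewrite x0 y0.
Qed.

(** The Pfaffian of the antisymmetric matrix theta_pair x_i x_j / x_i, multiplied
    by x_1 x_2 x_3. *)
Let pf (x1 x2 x3 x4 : R[i]) := x2 * theta_pair x1 x2 * theta_pair x3 x4
  - x3 * theta_pair x1 x3 * theta_pair x2 x4 + x3 * theta_pair x1 x4 * theta_pair x2 x3.

(** Up to the factor x_1, this is the 3 x 3 minor with rows 1, 2, 3 and columns
    1, 2, 4. *)
Let pfaffian_minor (x1 x2 x3 x4 : R[i]) : p != 0 ->
  x1 != 0 -> x2 != 0 -> x3 != 0 -> x4 != 0 ->
  theta_pair x1 x2 * pf x1 x2 x3 x4 = 0.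
Proof.
move=> p0 n1 n2 n3 n4.
pose x (i : 'I_3) := nth 0 [:: x1; x2; x3] i.
pose y (i : 'I_3) := nth 0 [:: x1; x2; x4] i.
have hx i : x i != 0 by case: i => [[|[|[|]]]].
have hy i : y i != 0 by case: i => [[|[|[|]]]].
have := theta_pair_det p0 hx hy; rewrite /det3 /x /y /=.
have diag z : z != 0 -> theta_pair z z = 0.
  by move=> z0; rewrite /theta_pair divff // theta_1 // mulr0.
rewrite !diag // (theta_pairC n1 n2) (theta_pairC n1 n3) (theta_pairC n2 n3) => h.
transitivity (x1 * 0); last by rewrite mulr0.
rewrite -h /pf; move: (theta_pair x1 x2) (theta_pair x1 x3) (theta_pair x1 x4)
  (theta_pair x2 x3) (theta_pair x2 x4) (theta_pair x3 x4) => f12 f13 f14 f23 f24 f34.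
by field; rewrite n1 n2.
Qed.

(** The Pfaffian vanishes at once unless the entries 12, 13 and 14 are all zero;
    in that case each of its three terms vanishes. *)
Let weierstrass_pf (x1 x2 x3 x4 : R[i]) : p != 0 ->
  x1 != 0 -> x2 != 0 -> x3 != 0 -> x4 != 0 -> pf x1 x2 x3 x4 = 0.
Proof.
move=> p0 n1 n2 n3 n4.
have [h12|h12] := eqVneq (theta_pair x1 x2) 0; last first.
  by have /eqP := pfaffian_minor p0 n1 n2 n3 n4; rewrite mulf_eq0 (negbTE h12) => /eqP.
have [h13|h13] := eqVneq (theta_pair x1 x3) 0; last first.
  have /eqP := pfaffian_minor p0 n1 n3 n2 n4; rewrite mulf_eq0 (negbTE h13) => /eqP.
  rewrite /pf (theta_pairC n2 n3) => h.
  transitivity (- (0 : R[i])); last by rewrite oppr0.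
  rewrite -{}h; move: (theta_pair x1 x2) (theta_pair x1 x3) (theta_pair x1 x4)
    (theta_pair x2 x3) (theta_pair x2 x4) (theta_pair x3 x4) => f12 f13 f14 f23 f24 f34.
  by field; rewrite ?n2 ?n3.
have [h14|h14] := eqVneq (theta_pair x1 x4) 0; last first.
  have /eqP := pfaffian_minor p0 n1 n4 n2 n3; rewrite mulf_eq0 (negbTE h14) => /eqP.
  rewrite /pf h12 h13 !(mulr0, mul0r) subr0 addr0 => /eqP.
  rewrite -mulrA mulf_eq0 (negbTE n4) /= => /eqP h.
  by rewrite subr0 add0r -mulrA h mulr0.
by rewrite /pf h12 h13 h14 !(mulr0, mul0r) subrr addr0.
Qed.

(** The three-term relation, written for the products
    theta (u c) * theta (u K / c), which are symmetric under the exchange of c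
    and K / c. A square root of K brings it to the form of the Pfaffian. *)
Lemma theta_three_term (K u w c c0 : R[i]) :
  K != 0 -> u != 0 -> w != 0 -> c != 0 -> c0 != 0 ->
  theta p (u * c) * theta p (u * K / c) * (theta p (w * c0) * theta p (w * K / c0)) =
  theta p (u * c0) * theta p (u * K / c0) * (theta p (w * c) * theta p (w * K / c))
  - w * c0 * theta p (u * w * K) * theta p (u / w) *
    (theta p (c / c0) * theta p (K / (c * c0))).
Proof.
move=> K0 u0 w0 cn c00.
have [pz|pn] := eqVneq p 0.
  have th a : theta p a = 1 - a.
    apply: (@cvgC_unique R (theta_part p a)); first exact: theta_cvg.
    have h : \forall m \near \oo, theta_part p a m = 1 - a.
      exists 1%N => // m /=; case: m => // m _.
      rewrite /theta_part pz big_nat_recl //= big1 ?mulr1 => [|j _].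
        by rewrite ?expr0 ?expr1 mul0r subr0 !mulr1.
      by rewrite !exprS !mul0r !mulr0 subr0 mulr1.
    by apply: cvg_near_cst; exact: h.
  by rewrite !th; field; rewrite ?K0 ?u0 ?w0 ?cn ?c00.
have [k kk] : exists k, k ^+ 2 = K by exists (sqrtc K); rewrite sqr_sqrtc.
have k0 : k != 0 by apply: contraNneq K0 => h; rewrite -kk h expr0n.
have := @weierstrass_pf (u * k) (w * k) (c / k) (c0 / k) pn.
rewrite !mulf_neq0 ?invr_neq0 // => /(_ isT isT isT isT).
rewrite /pf /theta_pair.
have -> : u * k * (w * k) = u * w * K by rewrite -kk; ring.
have -> : u * k / (w * k) = u / w by field; rewrite k0 w0.
have -> : c / k * (c0 / k) = (K / (c * c0))^-1 by rewrite -kk; field; rewrite k0 cn c00.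
have -> : c / k / (c0 / k) = c / c0 by field; rewrite k0 c00.
have -> : u * k * (c / k) = u * c by field.
have -> : u * k / (c / k) = u * K / c by rewrite -kk; field; rewrite k0 cn.
have -> : w * k * (c0 / k) = w * c0 by field.
have -> : w * k / (c0 / k) = w * K / c0 by rewrite -kk; field; rewrite k0 c00.
have -> : u * k * (c0 / k) = u * c0 by field.
have -> : u * k / (c0 / k) = u * K / c0 by rewrite -kk; field; rewrite k0 c00.
have -> : w * k * (c / k) = w * c by field.
have -> : w * k / (c / k) = w * K / c by rewrite -kk; field; rewrite k0 cn.
rewrite (thetaV hp) ?mulf_neq0 ?invr_neq0 ?mulf_neq0 // => h.
set t1 := theta p (u * c) in h *; set t2 := theta p (u * K / c) in h *.
set t3 := theta p (w * c0) in h *; set t4 := theta p (w * K / c0) in h *.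
set t5 := theta p (u * c0) in h *; set t6 := theta p (u * K / c0) in h *.
set t7 := theta p (w * c) in h *; set t8 := theta p (w * K / c) in h *.
set s1 := theta p (u * w * K) in h *; set s2 := theta p (u / w) in h *.
set s3 := theta p (c / c0) in h *; set s4 := theta p (K / (c * c0)) in h *.
apply/eqP; rewrite -subr_eq0; apply/eqP.
transitivity (- (k / c) * 0); last by rewrite mulr0.
rewrite -{}h -kk; field.
by rewrite k0 cn c00.
Qed.
End ThetaWeierstrass.

(** * Interpolation by theta functions *)

(** The properties of the theta function on which the summation rests. *)
Record theta_like (F : fieldType) (th : F -> F) : Prop := ThetaLike {
  th_1 : th 1 = 0;
  th_V : forall a, a != 0 -> th a^-1 = - th a / a;
  th_three_term : forall K u w c c0,
    K != 0 -> u != 0 -> w != 0 -> c != 0 -> c0 != 0 ->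
    th (u * c) * th (u * K / c) * (th (w * c0) * th (w * K / c0)) =
    th (u * c0) * th (u * K / c0) * (th (w * c) * th (w * K / c))
    - w * c0 * th (u * w * K) * th (u / w) *
      (th (c / c0) * th (K / (c * c0)));
  th_avoid : forall us : seq F, all (fun u => u != 0) us ->
    exists2 t, t != 0 & all (fun u => th (u * t) != 0) us
}.

Section Interpolation.
Variables (F : fieldType) (th : F -> F).
Hypothesis thP : theta_like th.

Definition theta_sym (K u c : F) : F := th (u * c) * th (u * K / c).

(** Functions of c that behave like sums of products of N factors
    theta_sym K u c; by the three-term relation such a function is a polynomial
    of degree at most N in the quotient of two fixed factors. *)
Definition theta_degree (K : F) (N : nat) (f : F -> F) : Prop :=
  forall w c0, w != 0 -> c0 != 0 -> theta_sym K w c0 != 0 ->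
  exists2 P : {poly F}, (size P <= N.+1)%N &
    forall c, c != 0 -> theta_sym K w c != 0 ->
      f c = theta_sym K w c ^+ N * P.[theta_sym K c0^-1 c / theta_sym K w c].

Lemma theta_degree_eq K N f g : (forall c, c != 0 -> f c = g c) ->
  theta_degree K N f -> theta_degree K N g.
Proof.
move=> fg hf w c0 w0 c00 hw; have [P sP hP] := hf w c0 w0 c00 hw.
by exists P => // c cn hc; rewrite -fg // hP.
Qed.

Lemma theta_degree_cst K k : theta_degree K 0 (fun=> k).
Proof.
move=> w c0 _ _ _; exists k%:P; first by rewrite size_polyC leq_b1.
by move=> c _ _; rewrite expr0 mul1r hornerC.
Qed.

Lemma theta_sym_three_term K u w c c0 :
  K != 0 -> u != 0 -> w != 0 -> c != 0 -> c0 != 0 ->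
  theta_sym K u c * theta_sym K w c0 = theta_sym K u c0 * theta_sym K w c
    - w * c0 * th (u * w * K) * th (u / w) * theta_sym K c0^-1 c.
Proof.
move=> K0 u0 w0 cn c00; rewrite /theta_sym.
have -> : c0^-1 * c = c / c0 by rewrite mulrC.
have -> : c0^-1 * K / c = K / (c * c0) by field; rewrite cn c00.
exact: (th_three_term thP).
Qed.

Lemma theta_degree_sym K u : K != 0 -> u != 0 -> theta_degree K 1 (theta_sym K u).
Proof.
move=> K0 u0 w c0 w0 c00 hw.
exists ((theta_sym K u c0 / theta_sym K w c0)%:P
  + (- (w * c0 * th (u * w * K) * th (u / w) / theta_sym K w c0)) *: 'X) => [|c cn hc].
  apply: leq_trans (size_polyD _ _) _; rewrite geq_max size_polyC.
  by rewrite (leq_trans (leq_b1 _)) // (leq_trans (size_scale_leq _ _)) // size_polyX.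
rewrite expr1 hornerD hornerC hornerZ hornerX; apply: (mulIf hw).
rewrite theta_sym_three_term //; field.
by rewrite hc hw.
Qed.

Lemma theta_degreeM K N M f g : theta_degree K N f -> theta_degree K M g ->
  theta_degree K (N + M) (fun c => f c * g c).
Proof.
move=> hf hg w c0 w0 c00 hw.
have [P sP hP] := hf w c0 w0 c00 hw; have [Q sQ hQ] := hg w c0 w0 c00 hw.
exists (P * Q) => [|c cn hc]; last by rewrite hP // hQ // hornerM exprD; ring.
apply: leq_trans (size_polyMleq _ _) _.
have : (size P + size Q <= N.+1 + M.+1)%N by rewrite leq_add.
by lia.
Qed.

Lemma theta_degreeD K N f g : theta_degree K N f -> theta_degree K N g ->
  theta_degree K N (fun c => f c + g c).
Proof.
move=> hf hg w c0 w0 c00 hw.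
have [P sP hP] := hf w c0 w0 c00 hw; have [Q sQ hQ] := hg w c0 w0 c00 hw.
exists (P + Q) => [|c cn hc]; last by rewrite hP // hQ // hornerD mulrDr.
by apply: leq_trans (size_polyD _ _) _; rewrite geq_max sP.
Qed.

Lemma theta_degreeZ K N f k : theta_degree K N f -> theta_degree K N (fun c => k * f c).
Proof. by move=> hf; apply: (@theta_degreeM _ 0) => //; exact: theta_degree_cst. Qed.

Lemma theta_degree0 K N : theta_degree K N (fun=> 0).
Proof.
by move=> w c0 _ _ _; exists 0 => [|c _ _]; rewrite ?size_poly0 // horner0 mulr0.
Qed.

Lemma theta_degree_sum K N (I : Type) (s : seq I) (Q : pred I) (f : I -> F -> F) :
  (forall i, Q i -> theta_degree K N (f i)) ->
  theta_degree K N (fun c => \sum_(i <- s | Q i) f i c).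
Proof.
move=> hf; elim: s => [|i s IH].
  by refine (theta_degree_eq _ (@theta_degree0 K N)) => c _; rewrite big_nil.
case Qi : (Q i); last by refine (theta_degree_eq _ IH) => c _; rewrite big_cons Qi.
by refine (theta_degree_eq _ (theta_degreeD (hf i Qi) IH)) => c _; rewrite big_cons Qi.
Qed.

Lemma theta_degree_prod K (I : Type) (s : seq I) (n : I -> nat) (f : I -> F -> F) :
  (forall i, theta_degree K (n i) (f i)) ->
  theta_degree K (\sum_(i <- s) n i)%N (fun c => \prod_(i <- s) f i c).
Proof.
move=> hf; elim: s => [|i s IH].
  by rewrite big_nil; refine (theta_degree_eq _ (@theta_degree_cst K 1)) => c _; rewrite big_nil.
by rewrite big_cons; refine (theta_degree_eq _ (theta_degreeM (hf i) IH)) => c _; rewrite big_cons.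
Qed.

Definition theta_apart (K c c' : F) : bool :=
  (th (c / c') != 0) && (th (K / (c * c')) != 0).

Lemma thetaV_eq0 a : a != 0 -> (th a^-1 == 0) = (th a == 0).
Proof.
by move=> a0; rewrite (th_V thP) // mulf_eq0 invr_eq0 (negbTE a0) orbF oppr_eq0.
Qed.

Lemma theta_apartC K c c' : c != 0 -> c' != 0 -> theta_apart K c c' = theta_apart K c' c.
Proof.
move=> c0 c'0; rewrite /theta_apart [c * c']mulrC; congr (_ && _).
by rewrite -[c / c']invf_div thetaV_eq0 ?mulf_neq0 ?invr_neq0.
Qed.

(** The polynomial that represents f has too many roots: by the three-term
    relation, points that are apart have different coordinates. *)
Lemma theta_degree_interpolation K N f (I : finType) (pt : I -> F) :
  K != 0 -> theta_degree K N f -> (N < #|I|)%N ->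
  (forall i, pt i != 0) -> (forall i j, i != j -> theta_apart K (pt i) (pt j)) ->
  (forall i, f (pt i) = 0) -> forall c, c != 0 -> f c = 0.
Proof.
move=> K0 hf NI pt0 apart zero c cn.
(* a reference factor that vanishes at none of the points involved *)
have [w w0 hw] : exists2 w, w != 0 &
    all (fun u => th (u * w) != 0) ([:: c; K / c] ++ [seq pt i | i <- enum I]
      ++ [seq K / pt i | i <- enum I]).
  apply: (th_avoid thP); rewrite !all_cat /= cn mulf_neq0 ?invr_neq0 //=.
  by apply/andP; split; apply/allP => _ /mapP[i _ ->] //; rewrite mulf_neq0 ?invr_neq0.
move: hw; rewrite !all_cat /= andbT => /and3P[/andP[hc1 hc2] /allP h1 /allP h2].
have hwc : theta_sym K w c != 0.
  by rewrite /theta_sym [w * c]mulrC -mulrA [w * (K / c)]mulrC mulf_neq0.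
have hwp i : theta_sym K w (pt i) != 0.
  rewrite /theta_sym mulf_neq0 //.
    by rewrite mulrC; apply: h1; apply: map_f; rewrite mem_enum.
  by rewrite -mulrA mulrC; apply: h2; apply: map_f; rewrite mem_enum.
have [i0 _] : {i0 : I | i0 \in I}.
  by apply/sigW/existsP; rewrite -[X in is_true X]negbK negb_exists; apply/negP => /forallP h;
    move: NI; rewrite eq_card0 // => i; apply/negbTE/h.
have [P sP hP] := hf w (pt i0) w0 (pt0 i0) (hwp i0).
pose X z := theta_sym K (pt i0)^-1 z / theta_sym K w z.
suff P0 : P = 0 by rewrite hP // P0 horner0 mulr0.
apply/eqP; apply: contraTT sP => Pn; rewrite -ltnNge.
have rts : all (root P) [seq X (pt i) | i <- enum I].
  apply/allP => _ /mapP[i _ ->]; rewrite rootE.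
  have /esym/eqP := hP _ (pt0 i) (hwp i); rewrite zero mulf_eq0 expf_eq0.
  by rewrite (negbTE (hwp i)) andbF.
have unq : uniq [seq X (pt i) | i <- enum I].
  rewrite map_inj_uniq ?enum_uniq // => i j eX; apply/eqP; apply: contraTT isT => ij.
  (* equal coordinates force a zero of the factor attached to pt j *)
  have /andP[a1 a2] := apart i j ij.
  have i00 := pt0 i0; have V0 := invr_neq0 i00.
  have := theta_sym_three_term K0 V0 w0 (pt0 i) (pt0 j).
  have -> : theta_sym K (pt i0)^-1 (pt i) * theta_sym K w (pt j) =
     theta_sym K (pt i0)^-1 (pt j) * theta_sym K w (pt i).
    have e1 : theta_sym K (pt i0)^-1 (pt i) = X (pt i) * theta_sym K w (pt i).
      by rewrite mulfVK.
    have e2 : theta_sym K (pt i0)^-1 (pt j) = X (pt j) * theta_sym K w (pt j).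
      by rewrite mulfVK.
    by rewrite e1 e2 eX mulrAC.
  move=> /eqP; rewrite -subr_eq0 opprB addrC subrK => /eqP h.
  have : theta_sym K w (pt i0) != 0 by exact: hwp.
  rewrite /theta_sym => hh; move: h => /eqP; rewrite /theta_sym !mulf_eq0.
  rewrite (negbTE w0) (negbTE (pt0 j)) /=.
  have -> : (pt i0)^-1 * w * K = w * K / pt i0 by ring.
  have -> : (pt i0)^-1 / w = (w * pt i0)^-1 by field; rewrite w0 i00.
  rewrite thetaV_eq0 ?mulf_neq0 //.
  move: hh; rewrite mulf_eq0 negb_or => /andP[/negbTE -> /negbTE ->] /=.
  rewrite mulrC (negbTE a1) /= => /eqP h2'; move: a2.
  have -> : K / (pt i * pt j) = (pt j)^-1 * K / pt i by field; rewrite !pt0.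
  by rewrite h2' eqxx.
have := max_poly_roots Pn rts unq; rewrite size_map -cardE => h.
exact: leq_ltn_trans NI h.
Qed.

(** The points are chosen one after the other by [th_avoid]. *)
Lemma theta_generic_points K (us : seq F) n : K != 0 -> all (fun u => u != 0) us ->
  exists pt : 'I_n -> F, [/\ forall i, pt i != 0,
    forall i, all (fun u => th (u * pt i) != 0) us &
    forall i j, i != j -> theta_apart K (pt i) (pt j)].
Proof.
move=> K0 us0.
suff [s [ss s0 sus ap]] : exists s : seq F, [/\ size s = n, all (fun t => t != 0) s,
    all (fun t => all (fun u => th (u * t) != 0) us) s & pairwise (theta_apart K) s].
  have hi (i : 'I_n) : nth 0 s i \in s by rewrite mem_nth ?ss.
  exists (fun i => nth 0 s i); split=> [i|i|i j ij].
  - exact: (allP s0).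
  - exact: (allP sus _ (hi i)).
  - have /(pairwiseP 0) h := ap.
    move: ij; rewrite neq_ltn => /orP[ij|ij].
      by apply: h; rewrite ?inE ?ss.
    rewrite theta_apartC; [|exact: (allP s0)|exact: (allP s0)].
    by apply: h; rewrite ?inE ?ss.
elim: n => [|n [s [ss s0 sus ap]]]; first by exists [::].
have [t t0 ht] : exists2 t, t != 0 &
    all (fun u => th (u * t) != 0) (us ++ [seq v^-1 | v <- s] ++ [seq v / K | v <- s]).
  apply: (th_avoid thP); rewrite !all_cat us0 /=.
  by apply/andP; split; apply/allP => _ /mapP[v vs ->];
    rewrite ?mulf_neq0 ?invr_neq0 //; apply: (allP s0).
move: ht; rewrite !all_cat => /and3P[h1 /allP h2 /allP h3].
exists (t :: s); split; rewrite /= ?ss ?t0 ?h1 ?s0 ?sus ?ap ?andbT //.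
apply/allP => v vs; rewrite /theta_apart; apply/andP; split.
  by rewrite mulrC; apply: h2; apply: map_f.
have v0 : v != 0 by apply: (allP s0).
have -> : K / (t * v) = (v / K * t)^-1 by field; rewrite t0 v0 K0.
by rewrite thetaV_eq0 ?mulf_neq0 ?invr_neq0 //; apply: h3; exact: (map_f (fun v => v / K)).
Qed.
End Interpolation.

(** * Shifted factorials and the translation of the summand *)

Section ShiftedFactorial.
Variables (F : fieldType) (th : F -> F) (q : F).
Hypotheses (thP : theta_like th) (q0 : q != 0).

Definition sfac (a : F) (m : nat) : F := \prod_(0 <= i < m) th (a * q ^+ i).

Lemma sfac0 a : sfac a 0 = 1.
Proof. by rewrite /sfac big_nil. Qed.

Lemma sfacS a m : sfac a m.+1 = sfac a m * th (a * q ^+ m).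
Proof. by rewrite /sfac big_nat_recr. Qed.

Lemma sfacD a m k : sfac a (m + k) = sfac a m * sfac (a * q ^+ m) k.
Proof.
elim: k => [|k IH]; first by rewrite addn0 sfac0 mulr1.
by rewrite addnS !sfacS IH -!mulrA exprD.
Qed.

Lemma sfac1 a : sfac a 1 = th a.
Proof. by rewrite sfacS sfac0 mul1r mulr1. Qed.

Lemma sfac_neq0 a m : (forall i, (i < m)%N -> th (a * q ^+ i) != 0) -> sfac a m != 0.
Proof.
by move=> h; rewrite /sfac big_mkord; apply/prodf_neq0 => i _; exact: h.
Qed.

Lemma sfac_eq0 a m i : (i < m)%N -> a * q ^+ i = 1 -> sfac a m = 0.
Proof.
move=> im h; apply/eqP; rewrite /sfac big_mkord.
by apply/prodf_eq0; exists (Ordinal im) => //=; rewrite h (th_1 thP).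
Qed.

(** Reverse the order of the factors, and apply the inversion formula to each. *)
Lemma sfac_rev e m : e != 0 ->
  sfac (q / (q ^+ m * e)) m * \prod_(0 <= i < m) (- (e * q ^+ i)) = sfac e m.
Proof.
move=> e0; rewrite /sfac [X in X * _]big_nat_rev -big_split /=.
rewrite big_nat [RHS]big_nat; apply: eq_bigr => i /andP[_ im].
have -> : q / (q ^+ m * e) * q ^+ (0 + m - i.+1) = (e * q ^+ i)^-1.
  rewrite add0n -{1}(subnKC im) exprD exprS; field.
  by rewrite e0 q0 !expf_neq0.
by rewrite (th_V thP) ?mulf_neq0 ?expf_neq0 //; field; rewrite e0 expf_neq0.
Qed.

Lemma prod_odd_powers m : \prod_(0 <= i < m) (q * q ^+ i * q ^+ i) = q ^+ m ^+ m.
Proof.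
elim: m => [|m IH]; first by rewrite big_nil.
rewrite big_nat_recr //= IH exprSr !exprS exprMn.
by rewrite -!exprM; ring.
Qed.
End ShiftedFactorial.

Section PairSums.
Variables (T : Type) (idx : T) (op : Monoid.com_law idx).

(** An index s different from rho forms exactly one ordered pair with rho. *)
Lemma big_pairs_with n (rho : 'I_n) (f : 'I_n -> T) :
  \big[op/idx]_(r < n) \big[op/idx]_(s < n | (r < s)%N)
     (if r == rho then f s else if s == rho then f r else idx)
  = \big[op/idx]_(s < n | s != rho) f s.
Proof.
rewrite (bigD1 rho) //= eqxx.
rewrite [X in op _ X](_ : _ = \big[op/idx]_(r < n | (r < rho)%N) f r); last first.
  rewrite [RHS]big_mkcond [LHS]big_mkcond /=; apply: eq_bigr => r _.
  have [->|rn] /= := eqVneq r rho; first by rewrite ltnn.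
  case: ltnP => rl.
    rewrite (bigD1 rho) //= eqxx big1 ?Monoid.mulm1 // => s /andP[_ sn].
    by rewrite (negbTE sn).
  rewrite big1 // => s rs; case: eqP => // h; move: rs; rewrite h.
  by move=> /(leq_ltn_trans rl); rewrite ltnn.
rewrite (bigID (fun s : 'I_n => (rho < s)%N) (fun s => s != rho)) /=.
congr (op _ _); apply: eq_bigl => s; rewrite -(inj_eq val_inj) /=; lia.
Qed.
End PairSums.

Section Summand.
Variables (F : fieldType) (th : F -> F) (q b : F) (n : nat).
Hypotheses (thP : theta_like th) (q0 : q != 0) (b0 : b != 0).
Local Notation sfac := (sfac th q).
Implicit Types (x : 'I_n -> F) (N j : 'I_n -> nat).

(** The factor of the summand attached to a parameter y. It occurs for y = c, d, e
    and also for y = a x_1, ..., a x_n, which allows these parameters to exchange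
    their roles. *)
Definition gfac x a N j (y : F) : F :=
  sfac y (weight j) * \prod_(s < n) sfac (a * (x s * q ^+ j s) * q / y) (N s - j s).

Definition power_part x (a : F) j : F :=
  (b / a) ^+ weight j * \prod_(r < n) x r ^+ j r
  / q ^+ (\sum_(r < n) \sum_(s < n | (r < s)%N) j r * j s)%N.

Definition core x a N j : F :=
  \prod_(r < n) (th (a * q ^+ weight j * (x r * q ^+ j r))
     * sfac (b * (x r * q ^+ j r) / (a * q ^+ weight j)) (N r - j r)
     / sfac (a * x r * q) (N r + weight j))
  * \prod_(r < n) \prod_(s < n) sfac (b * (x r * q ^+ N r) * x s) (j s)
  / (\prod_(r < n) \prod_(s < n | (r < s)%N) sfac (b * x r * x s) (j r + j s)
    * \prod_(r < n) \prod_(s < n)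
        sfac (q * (x r * q ^+ j r) / (x s * q ^+ j s)) (N r - j r))
  * power_part x a j.

Definition addv j (l : 'I_n -> nat) : 'I_n -> nat := fun r => (j r + l r)%N.
Definition dilate x (l : 'I_n -> nat) : 'I_n -> F := fun r => x r * q ^+ l r.

Lemma weight_addv j l : weight (addv j l) = (weight j + weight l)%N.
Proof. by rewrite /weight big_split. Qed.

Lemma dilate_addv x j l r : x r * q ^+ addv j l r = dilate x l r * q ^+ j r.
Proof. by rewrite /addv /dilate addnC exprD mulrA. Qed.

Lemma gfac_addv x a N j l y : y != 0 ->
  gfac x a (addv N l) (addv j l) y =
  sfac y (weight l) * gfac (dilate x l) (a * q ^+ weight l) N j (y * q ^+ weight l).
Proof.
move=> y0; rewrite /gfac weight_addv addnC sfacD -!mulrA; congr (_ * (_ * _)).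
apply: eq_bigr => s _; rewrite dilate_addv /addv subnDr; congr (sfac _ _).
by field; rewrite y0 expf_neq0.
Qed.

Lemma mul_weights (u v : 'I_n -> nat) : (weight u * weight v =
  \sum_(r < n) \sum_(s < n | (r < s)%N) (u r * v s + v r * u s) + \sum_(r < n) u r * v r)%N.
Proof.
rewrite /weight big_distrl /=.
under eq_bigr => r _ do rewrite big_distrr /=.
transitivity (\sum_(r < n) (\sum_(s < n | (r < s)%N) u r * v s +
    (\sum_(s < n | (s < r)%N) u r * v s + u r * v r)))%N.
  apply: eq_bigr => r _.
  rewrite (bigID (fun s : 'I_n => (r < s)%N)) /=; congr addn.
  rewrite (bigD1 r) ?ltnn //= addnC; congr addn.
  by apply: eq_bigl => s; rewrite -(inj_eq val_inj) /=; lia.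
rewrite !big_split /= addnA; congr addn.
under [in RHS]eq_bigr => r _ do rewrite big_split /=.
rewrite big_split /=; congr addn.
rewrite (exchange_big_dep xpredT) //=.
by apply: eq_bigr => s _; apply: eq_bigr => r _; rewrite mulnC.
Qed.

(** The powers of q coming from the quadratic exponent cancel against those from
    the dilation of a and x, by the expansion of the product of two weights. *)
Lemma power_part_addv x a j l : a != 0 ->
  power_part x a (addv j l) =
  power_part x a l * power_part (dilate x l) (a * q ^+ weight l) j.
Proof.
move=> a0; rewrite /power_part weight_addv.
have -> : (\sum_(r < n) \sum_(s < n | (r < s)%N) addv j l r * addv j l s =
   (\sum_(r < n) \sum_(s < n | (r < s)%N) l r * l s) +
   (\sum_(r < n) \sum_(s < n | (r < s)%N) j r * j s) +
   (\sum_(r < n) \sum_(s < n | (r < s)%N) (l r * j s + j r * l s)))%N.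
  rewrite -!big_split /=; apply: eq_bigr => r _; rewrite -!big_split /=.
  by apply: eq_bigr => s _; rewrite /addv; ring.
have hx : (\prod_(r < n) x r ^+ addv j l r) * q ^+ (\sum_(r < n) l r * j r)%N =
    (\prod_(r < n) x r ^+ l r) * (\prod_(r < n) dilate x l r ^+ j r).
  rewrite expr_sum -!big_split /=; apply: eq_bigr => r _.
  by rewrite /addv /dilate exprD exprMn exprM; ring.
have hl := mul_weights l j; move: hx hl.
set S := (\sum_(r < n) \sum_(s < n | (r < s)%N) (l r * j s + _))%N.
set D := (\sum_(r < n) l r * j r)%N.
set L := (\sum_(r < n) \sum_(s < n | (r < s)%N) l r * l s)%N.
set J := (\sum_(r < n) \sum_(s < n | (r < s)%N) j r * j s)%N => hx hl.
have qn k : q ^+ k != 0 by rewrite expf_neq0.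
have hq : q ^+ weight l ^+ weight j = q ^+ S * q ^+ D by rewrite -exprM hl exprD.
apply: (mulIf (qn D)).
have -> : (b / (a * q ^+ weight l)) ^+ weight j = (b / a) ^+ weight j / (q ^+ S * q ^+ D).
  by rewrite -hq -expr_div_n; congr (_ ^+ _); field; rewrite a0 qn.
rewrite mulrAC -[_ * _ * q ^+ D]mulrA hx !exprD; field.
by rewrite !qn.
Qed.

(** The factor by which the summand changes when the lattice of summation is
    translated by l and the parameters are dilated accordingly. *)
Definition shift_factor x a N (l : 'I_n -> nat) : F :=
  \prod_(r < n) \prod_(s < n) sfac (b * (x r * q ^+ N r) * x s) (l s)
  / \prod_(r < n) \prod_(s < n | (r < s)%N) sfac (b * x r * x s) (l r + l s)
  / \prod_(r < n) sfac (a * x r * q) (weight l + l r)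
  * power_part x a l.

(** The numbers a q^|j|, x_r q^(j_r) and x_r q^(N_r) are unchanged when j and N
    are translated by l and a, x are dilated by l. *)
Lemma core_addv x a N j l : a != 0 ->
  core x a (addv N l) (addv j l) =
  shift_factor x a (addv N l) l * core (dilate x l) (a * q ^+ weight l) N j.
Proof.
move=> a0; rewrite /core /shift_factor power_part_addv // weight_addv.
have eA : a * q ^+ (weight j + weight l) = a * q ^+ weight l * q ^+ weight j.
  by rewrite addnC exprD mulrA.
have -> : \prod_(r < n) (th (a * q ^+ (weight j + weight l) * (x r * q ^+ addv j l r))
     * sfac (b * (x r * q ^+ addv j l r) / (a * q ^+ (weight j + weight l)))
         (addv N l r - addv j l r)
     / sfac (a * x r * q) (addv N l r + (weight j + weight l))) =
  (\prod_(r < n) sfac (a * x r * q) (weight l + l r))^-1 *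
  \prod_(r < n) (th (a * q ^+ weight l * q ^+ weight j * (dilate x l r * q ^+ j r))
     * sfac (b * (dilate x l r * q ^+ j r) / (a * q ^+ weight l * q ^+ weight j)) (N r - j r)
     / sfac (a * q ^+ weight l * dilate x l r * q) (N r + weight j)).
  rewrite -[X in _ = X * _]prodfV -[RHS]big_split /=; apply: eq_bigr => r _.
  rewrite eA dilate_addv /addv subnDr.
  have -> : (N r + l r + (weight j + weight l) = weight l + l r + (N r + weight j))%N by lia.
  rewrite sfacD [(sfac _ _ * sfac _ _)^-1]invfM.
  have -> : a * x r * q * q ^+ (weight l + l r) = a * q ^+ weight l * dilate x l r * q.
    by rewrite /dilate exprD; ring.
  by ring.
have -> : \prod_(r < n) \prod_(s < n) sfac (b * (x r * q ^+ addv N l r) * x s) (addv j l s) =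
  \prod_(r < n) \prod_(s < n) sfac (b * (x r * q ^+ addv N l r) * x s) (l s) *
  \prod_(r < n) \prod_(s < n) sfac (b * (dilate x l r * q ^+ N r) * dilate x l s) (j s).
  rewrite -big_split /=; apply: eq_bigr => r _; rewrite -big_split /=; apply: eq_bigr => s _.
  rewrite [addv j l s]addnC sfacD dilate_addv; congr (_ * sfac _ _).
  by rewrite /dilate; ring.
have -> : \prod_(r < n) \prod_(s < n | (r < s)%N) sfac (b * x r * x s) (addv j l r + addv j l s) =
  \prod_(r < n) \prod_(s < n | (r < s)%N) sfac (b * x r * x s) (l r + l s) *
  \prod_(r < n) \prod_(s < n | (r < s)%N) sfac (b * dilate x l r * dilate x l s) (j r + j s).
  rewrite -big_split /=; apply: eq_bigr => r _; rewrite -big_split /=; apply: eq_bigr => s _.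
  have -> : (addv j l r + addv j l s = l r + l s + (j r + j s))%N by rewrite /addv; lia.
  rewrite sfacD; congr (_ * sfac _ _).
  by rewrite /dilate exprD; ring.
have -> : \prod_(r < n) \prod_(s < n) sfac (q * (x r * q ^+ addv j l r) / (x s * q ^+ addv j l s))
     (addv N l r - addv j l r) =
  \prod_(r < n) \prod_(s < n) sfac (q * (dilate x l r * q ^+ j r) / (dilate x l s * q ^+ j s))
     (N r - j r).
  apply: eq_bigr => r _; apply: eq_bigr => s _.
  by rewrite !dilate_addv /addv subnDr.
rewrite !invfM; ring.
Qed.
End Summand.

(** * The multiple elliptic Jackson summation *)

Section Jackson.
Variables (F : fieldType) (th : F -> F) (q b : F) (n : nat).
Hypotheses (thP : theta_like th) (q0 : q != 0) (b0 : b != 0).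
Hypothesis q_generic : forall m, th (q ^+ m.+1) != 0.
Local Notation sfac := (sfac th q).
Local Notation gfac := (gfac th q).
Local Notation core := (core th q b).
Implicit Types (x : 'I_n -> F) (N j l : 'I_n -> nat).

Let qX k : q ^+ k != 0. Proof. by rewrite expf_neq0. Qed.

Definition jackson_term x a N c d e j : F :=
  core x a N j * \prod_(s < n) gfac x a N j (a * x s)
  * (gfac x a N j c * gfac x a N j d * gfac x a N j e).

Definition jackson_sum x a N c d e : F :=
  \sum_(j : {dffun forall r : 'I_n, 'I_(N r).+1})
     jackson_term x a N c d e (fun r => j r : nat).

Definition jackson_prod x a N c d e : F :=
  \prod_(r < n) (th (a * x r) * (sfac (b * c * x r / a) (N r)
     * sfac (b * d * x r / a) (N r) * sfac (b * e * x r / a) (N r))).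

(** The conditions of general position are stable under the dilations of a and x
    that accompany a translation of the summation index. *)
Record generic x (a : F) : Prop := Generic {
  gen_x : forall r, x r != 0;
  gen_ax : forall r m, th (a * x r * q ^+ m.+1) != 0;
  gen_bxx : forall r s m, r != s -> th (b * x r * x s * q ^+ m) != 0;
  gen_xx : forall r s k m, r != s -> th (x r * q ^+ k / (x s * q ^+ m)) != 0
}.

Lemma generic_dilate x a l : generic x a -> generic (dilate q x l) (a * q ^+ weight l).
Proof.
case=> g1 g2 g3 g4; split=> [r|r m|r s m rs|r s k m rs]; rewrite /dilate.
- by rewrite mulf_neq0.
- have -> : a * q ^+ weight l * (x r * q ^+ l r) * q ^+ m.+1 =
    a * x r * q ^+ (weight l + l r + m).+1 by rewrite !exprS !exprD; ring.
  exact: g2.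
- have -> : b * (x r * q ^+ l r) * (x s * q ^+ l s) * q ^+ m =
    b * x r * x s * q ^+ (l r + l s + m) by rewrite !exprD; ring.
  exact: g3.
- by rewrite -[x r * _ * _]mulrA -[x s * _ * _]mulrA -!exprD; exact: g4.
Qed.

Definition single (rho : 'I_n) (i : nat) : 'I_n -> nat :=
  fun r => if r == rho then i else 0%N.

Lemma weight_single rho i : weight (single rho i) = i.
Proof.
rewrite /weight (bigD1 rho) //= /single eqxx big1 ?addn0 // => r rr.
by rewrite (negbTE rr).
Qed.

Lemma shift_factor_single x a N rho i :
  shift_factor th q b x a N (single rho i) =
  \prod_(r < n) sfac (b * (x r * q ^+ N r) * x rho) i
  / \prod_(s < n | s != rho) sfac (b * x rho * x s) i
  / \prod_(r < n) sfac (a * x r * q) (i + single rho i r)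
  * (b * x rho / a) ^+ i.
Proof.
rewrite /shift_factor /power_part weight_single; congr (_ / _ / _ * _).
- apply: eq_bigr => r _; rewrite (bigD1 rho) //= {1}/single eqxx big1 ?mulr1 // => s sr.
  by rewrite /single (negbTE sr) sfac0.
- rewrite -(big_pairs_with _ rho (fun s => sfac (b * x rho * x s) i)).
  apply: eq_bigr => r _; apply: eq_bigr => s rs; rewrite /single.
  case: (eqVneq r rho) => [er|er]; case: (eqVneq s rho) => [es|es].
  + by move: rs; rewrite er es ltnn.
  + by rewrite addn0 er.
  + by rewrite add0n es mulrAC.
  + by rewrite addn0 sfac0.
- have -> : (\sum_(r < n) \sum_(s < n | (r < s)%N) single rho i r * single rho i s = 0)%N.
    apply: big1 => r _; apply: big1 => s rs; rewrite /single.
    case: (eqVneq r rho) => [er|//]; case: (eqVneq s rho) => [es|]; last by rewrite muln0.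
    by move: rs; rewrite er es ltnn.
  rewrite expr0 invr1 mulr1 (bigD1 rho) //= {1}/single eqxx big1 ?mulr1 => [|r rr].
    by rewrite -exprMn; congr (_ ^+ _); ring.
  by rewrite /single (negbTE rr) expr0.
Qed.

Let th_head a m : sfac a m * th (a * q ^+ m) = th a * sfac (a * q) m.
Proof. by rewrite -sfacS -add1n sfacD sfac1 expr1. Qed.

(** Since b d x / a = q^(1 - i) / e, reversal turns the factorials on the right
    into those in e and d; the powers of q that appear multiply up to the power
    of b x / a on the left. *)
Lemma sfac_pair_rev (a x c d e : F) i : a != 0 -> x != 0 -> d != 0 -> e != 0 ->
  c = a * x * q ^+ i -> b * c * d * e = q * a ^+ 2 ->
  (b * x / a) ^+ i * (sfac d i * sfac e i) =
  sfac (b * d * x / a) i * sfac (b * e * x / a) i.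
Proof.
move=> a0 x0 d0 e0 hc bal.
have bal' : b * x * q ^+ i * d * e = q * a.
  apply: (mulfI a0); transitivity (b * c * d * e); first by rewrite hc; ring.
  by rewrite bal; ring.
have -> : b * d * x / a = q / (q ^+ i * e).
  apply: (mulIf e0); apply: (mulIf (qX i)); apply: (mulIf a0).
  transitivity (b * x * q ^+ i * d * e); first by field.
  by rewrite bal'; field; rewrite e0 qX.
have -> : b * e * x / a = q / (q ^+ i * d).
  apply: (mulIf d0); apply: (mulIf (qX i)); apply: (mulIf a0).
  transitivity (b * x * q ^+ i * d * e); first by field.
  by rewrite bal'; field; rewrite d0 qX.
rewrite -(sfac_rev thP q0 i d0) -(sfac_rev thP q0 i e0).
set A := sfac _ i; set B := sfac _ i.
transitivity (A * B * ((b * x / a) ^+ i *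
  (\prod_(0 <= k < i) (- (d * q ^+ k)) * \prod_(0 <= k < i) (- (e * q ^+ k))))).
  by ring.
transitivity (A * B * 1); last by ring.
congr (_ * _).
have -> : (b * x / a) ^+ i = \prod_(0 <= k < i) (b * x / a) by rewrite prodr_const_nat subn0.
rewrite -!big_split /=.
have -> : \prod_(0 <= k < i) (b * x / a * (- (d * q ^+ k) * - (e * q ^+ k))) =
   \prod_(0 <= k < i) (q * q ^+ k * q ^+ k) * \prod_(0 <= k < i) (q ^+ i)^-1.
  rewrite -big_split /=; apply: eq_bigr => k _.
  transitivity (b * x * q ^+ i * d * e / a * q ^+ k * q ^+ k / q ^+ i).
    by field; rewrite a0 qX.
  by rewrite bal' mulfK.
by rewrite prod_odd_powers prodr_const_nat subn0 exprVn divff // expf_neq0.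
Qed.

(** Compatibility of the product side with the translation: the products of
    2 i + 1 theta functions on both sides agree, and the remaining factors are
    matched by reversing the factorials in d and e. *)
Lemma jackson_prod_shift x (a : F) N c d e rho i : generic x a ->
  a != 0 -> d != 0 -> e != 0 -> c = a * x rho * q ^+ i -> b * c * d * e = q * a ^+ 2 ->
  let l := single rho i in
  shift_factor th q b x a (addv N l) l * \prod_(s < n) sfac (a * x s) i
    * (sfac c i * sfac d i * sfac e i)
    * jackson_prod (dilate q x l) (a * q ^+ i) N c (d * q ^+ i) (e * q ^+ i)
  = jackson_prod x a (addv N l) c d e.
Proof.
move=> [g1 g2 g3 g4] a0 d0 e0 hc bal l; rewrite shift_factor_single.
have rv := sfac_pair_rev a0 (g1 rho) d0 e0 hc bal.
have -> : \prod_(s < n | s != rho) sfac (b * x rho * x s) i =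
   \prod_(s < n) (if s == rho then 1 else sfac (b * x rho * x s) i).
  by rewrite big_mkcond; apply: eq_bigr => s _; rewrite if_neg.
rewrite /jackson_prod.
set T := fun r => sfac (b * (x r * q ^+ addv N l r) * x rho) i
  / (if r == rho then 1 else sfac (b * x rho * x r) i)
  / sfac (a * x r * q) (i + l r) * sfac (a * x r) i *
  (th (a * q ^+ i * dilate q x l r) * (sfac (b * c * dilate q x l r / (a * q ^+ i)) (N r)
     * sfac (b * (d * q ^+ i) * dilate q x l r / (a * q ^+ i)) (N r)
     * sfac (b * (e * q ^+ i) * dilate q x l r / (a * q ^+ i)) (N r))).
transitivity (\prod_(r < n) T r * ((b * x rho / a) ^+ i * (sfac c i * sfac d i * sfac e i))).
  rewrite /T !big_split /= !prodfV; ring.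
have nz_ax r k : sfac (a * x r * q) k != 0.
  by apply: sfac_neq0 => m _; rewrite -mulrA -exprS; exact: g2.
rewrite (bigD1 rho) //= [RHS](bigD1 rho) //= mulrAC; congr (_ * _); last first.
  apply: eq_bigr => r rr; rewrite /T /l /addv /dilate /single (negbTE rr) !addn0 expr0 mulr1.
  have nz_b : sfac (b * x rho * x r) i != 0.
    by apply: sfac_neq0 => m _; apply: g3; rewrite eq_sym.
  have e1 : sfac (a * x r) i * th (a * q ^+ i * x r) = th (a * x r) * sfac (a * x r * q) i.
    by rewrite -th_head; congr (_ * th _); ring.
  have e2 : sfac (b * (x r * q ^+ N r) * x rho) i * sfac (b * c * x r / (a * q ^+ i)) (N r) =
     sfac (b * c * x r / a) (N r) * sfac (b * x rho * x r) i.
    have -> : b * c * x r / (a * q ^+ i) = b * x rho * x r by rewrite hc; field; rewrite a0 qX.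
    have -> : b * c * x r / a = b * x rho * x r * q ^+ i by rewrite hc; field.
    rewrite [RHS]mulrC -sfacD addnC sfacD mulrC; congr (_ * sfac _ _); ring.
  have -> : b * (d * q ^+ i) * x r / (a * q ^+ i) = b * d * x r / a by field; rewrite a0 qX.
  have -> : b * (e * q ^+ i) * x r / (a * q ^+ i) = b * e * x r / a by field; rewrite a0 qX.
  apply: (mulIf (nz_ax r i)); apply: (mulIf nz_b).
  set D := sfac (b * d * x r / a) _; set E := sfac (b * e * x r / a) _.
  transitivity ((sfac (b * (x r * q ^+ N r) * x rho) i * sfac (b * c * x r / (a * q ^+ i)) (N r)) *
     (sfac (a * x r) i * th (a * q ^+ i * x r)) * D * E).
    by field; rewrite nz_ax nz_b.
  by rewrite e1 e2; ring.
rewrite /T /l /addv /dilate /single eqxx invr1 mulr1.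
have e1 : sfac (a * x rho) i * sfac c i * th (a * q ^+ i * (x rho * q ^+ i)) =
   th (a * x rho) * sfac (a * x rho * q) (i + i).
  rewrite -th_head sfacD hc; congr (_ * th _); rewrite exprD; ring.
have e2 : sfac (b * (x rho * q ^+ (N rho + i)) * x rho) i *
    sfac (b * c * (x rho * q ^+ i) / (a * q ^+ i)) (N rho) = sfac (b * c * x rho / a) (N rho + i).
  have -> : b * c * (x rho * q ^+ i) / (a * q ^+ i) = b * c * x rho / a by field; rewrite a0 qX.
  rewrite sfacD mulrC; congr (_ * sfac _ _); rewrite hc exprD; field.
  by rewrite a0.
have e3 y : sfac (b * (y * q ^+ i) * (x rho * q ^+ i) / (a * q ^+ i)) (N rho) * sfac (b * y * x rho / a) i =
   sfac (b * y * x rho / a) (N rho + i).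
  rewrite addnC sfacD mulrC; congr (_ * sfac _ _); field; rewrite a0 qX //.
rewrite -e2 -(e3 d) -(e3 e).
set D := sfac (b * (d * _) * _ / _) _; set E := sfac (b * (e * _) * _ / _) _.
set C := sfac (b * c * _ / _) _; set U := sfac (b * (x rho * _) * _) _.
set V := sfac (b * d * _ / _) _ in rv *; set W := sfac (b * e * _ / _) _ in rv *.
apply: (mulIf (nz_ax rho (i + i)%N)).
transitivity (U * C * D * E * (sfac (a * x rho) i * sfac c i * th (a * q ^+ i * (x rho * q ^+ i)))
   * ((b * x rho / a) ^+ i * (sfac d i * sfac e i))).
  have h0 := nz_ax rho (i + i)%N; move: h0; set Z := sfac _ (i + i) => h0.
  set Y := (_ / a) ^+ i; field; rewrite h0 //.
rewrite e1 rv; ring.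
Qed.

(** One of the factors is theta 1. *)
Lemma gfac_eq0 x (a : F) N j rho i : x rho != 0 -> a != 0 -> (j rho < i)%N -> (i <= N rho)%N ->
  gfac x a N j (a * x rho * q ^+ i) = 0.
Proof.
move=> x0 a0 ji iN; rewrite /gfac; apply/eqP; rewrite mulf_eq0; apply/orP; right.
apply/prodf_eq0; exists rho => //; apply/eqP.
apply: (@sfac_eq0 _ _ _ thP _ _ (i - (j rho).+1)); first by lia.
have -> : q ^+ i = q ^+ j rho * q * q ^+ (i - (j rho).+1).
  by rewrite -exprSr -exprD subnKC.
by field; rewrite x0 a0 !qX q0.
Qed.

Lemma sum_box_addv N l (f : ('I_n -> nat) -> F) :
  (forall j, (exists r, j r < l r)%N -> f j = 0) ->
  \sum_(j : {dffun forall r : 'I_n, 'I_(addv N l r).+1}) f (fun r => j r : nat) =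
  \sum_(j : {dffun forall r : 'I_n, 'I_(N r).+1}) f (addv (fun r => j r : nat) l).
Proof.
move=> f0; rewrite (bigID (fun j : {dffun forall r : 'I_n, 'I_(addv N l r).+1} =>
   [forall r, l r <= j r]%N)) /= [X in _ + X]big1 ?addr0 => [|j]; last first.
  by rewrite negb_forall => /existsP[r]; rewrite -ltnNge => h; apply: f0; exists r.
pose h (j : {dffun forall r : 'I_n, 'I_(N r).+1}) : {dffun forall r : 'I_n, 'I_(addv N l r).+1} :=
  [ffun r => inord (j r + l r)].
pose h' (j : {dffun forall r : 'I_n, 'I_(addv N l r).+1}) : {dffun forall r : 'I_n, 'I_(N r).+1} :=
  [ffun r => inord (j r - l r)].
have hE (j : {dffun forall r : 'I_n, 'I_(N r).+1}) r : h j r = (j r + l r)%N :> nat.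
  by rewrite ffunE inordK // ltnS leq_add2r -ltnS.
rewrite (reindex_onto h h') => [|j /forallP lj]; last first.
  apply/ffunP => r; apply: val_inj; rewrite /= hE ffunE inordK ?subnK //.
  by rewrite ltnS leq_subLR addnC -ltnS ltn_ord.
apply: eq_big => [j|j _].
  have -> : [forall r, l r <= h j r]%N by apply/forallP => r; rewrite hE leq_addl.
  apply/eqP/ffunP => r; apply: val_inj => /=.
  by rewrite ffunE hE addnK inord_val.
by congr f; apply/funext => r; rewrite hE.
Qed.

Lemma jackson_term_addv x (a : F) N j c d e rho i :
  (forall r, x r != 0) -> a != 0 -> d != 0 -> e != 0 -> c = a * x rho * q ^+ i ->
  let l := single rho i in
  jackson_term x a (addv N l) c d e (addv j l) =
  shift_factor th q b x a (addv N l) l * \prod_(s < n) sfac (a * x s) i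
    * (sfac c i * sfac d i * sfac e i)
    * jackson_term (dilate q x l) (a * q ^+ i) N c (d * q ^+ i) (e * q ^+ i) j.
Proof.
move=> x0 a0 d0 e0 hc l; have c0 : c != 0 by rewrite hc !mulf_neq0.
rewrite /jackson_term core_addv // !gfac_addv // weight_single.
set G := gfac (dilate q x l) _ N j.
have -> : \prod_(s < n) gfac x a (addv N l) (addv j l) (a * x s) =
   \prod_(s < n) sfac (a * x s) i * \prod_(s < n) G (a * x s * q ^+ i).
  rewrite -big_split /=; apply: eq_bigr => s _.
  by rewrite gfac_addv ?weight_single // mulf_neq0.
(* the arguments a x_rho and c exchange their roles *)
have -> : \prod_(s < n) G (a * q ^+ i * dilate q x l s) =
   G (c * q ^+ i) * \prod_(s < n | s != rho) G (a * x s * q ^+ i).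
  rewrite (bigD1 rho) //= /dilate /l /single eqxx; congr (G _ * _).
    by rewrite hc; ring.
  by apply: eq_bigr => s sr; rewrite (negbTE sr) expr0 mulr1 mulrAC.
by rewrite [\prod_(s < n) G _](bigD1 rho) //= -hc; ring.
Qed.

Lemma jackson_sum_shift x (a : F) N c d e rho i :
  (forall r, x r != 0) -> a != 0 -> d != 0 -> e != 0 -> c = a * x rho * q ^+ i ->
  let l := single rho i in
  jackson_sum x a (addv N l) c d e =
  shift_factor th q b x a (addv N l) l * \prod_(s < n) sfac (a * x s) i
    * (sfac c i * sfac d i * sfac e i)
    * jackson_sum (dilate q x l) (a * q ^+ i) N c (d * q ^+ i) (e * q ^+ i).
Proof.
move=> x0 a0 d0 e0 hc l; rewrite /jackson_sum sum_box_addv => [|j [r jl]]; last first.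
  rewrite /jackson_term [X in _ * (X * _ * _)](_ : _ = 0) ?(mul0r, mulr0) //.
  move: jl; rewrite /l /single; case: eqP => // -> jl.
  by rewrite hc gfac_eq0 // /addv /single eqxx leq_addl.
rewrite mulr_sumr; apply: eq_bigr => j _; exact: jackson_term_addv.
Qed.

(** The factorial of 1 of length |j| removes all terms but the one with j = 0. *)
Lemma jackson_sum_1 x (a : F) N d e : generic x a -> a != 0 -> d != 0 -> e != 0 ->
  b * d * e = q * a ^+ 2 -> jackson_sum x a N 1 d e = jackson_prod x a N 1 d e.
Proof.
move=> [g1 g2 g3 g4] a0 d0 e0 bal.
pose j0 : {dffun forall r : 'I_n, 'I_(N r).+1} := [ffun r => ord0].
have j0E : (fun r => j0 r : nat) = (fun=> 0%N) by apply/funext => r; rewrite ffunE.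
rewrite /jackson_sum (bigD1 j0) //= [X in _ + X]big1 ?addr0 => [|j jn]; last first.
  rewrite /jackson_term [X in _ * (X * _ * _)](_ : _ = 0) ?(mul0r, mulr0) //.
  rewrite /gfac (@sfac_eq0 _ _ _ thP 1 _ 0) ?mul0r ?mulr1 //.
  rewrite lt0n; apply: contraNneq jn => w0; apply/eqP/ffunP => r; apply: val_inj.
  rewrite ffunE /=; apply/eqP; rewrite -leqn0.
  by rewrite -[X in (_ <= X)%N]w0 /weight (bigD1 r) //= leq_addr.
rewrite j0E; have w0 : @weight n (fun=> 0%N) = 0%N by rewrite /weight big1.
have nz r s k : sfac (q * x r / x s) k != 0.
  apply: sfac_neq0 => m _; have [->|rs] := eqVneq r s.
    by rewrite mulfK // -exprS; exact: q_generic.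
  have := g4 r s m.+1 0%N rs; rewrite expr0 mulr1 exprS.
  by apply: contraNN => /eqP h; apply/eqP; rewrite -[RHS]h; congr th; ring.
have nz_ax r k : sfac (a * x r * q) k != 0.
  by apply: sfac_neq0 => m _; rewrite -mulrA -exprS; exact: g2.
rewrite /jackson_term /core /power_part /gfac w0 /=.
have -> : \prod_(r < n) \prod_(s < n) sfac (b * (x r * q ^+ N r) * x s) 0 = 1.
  by apply: big1 => r _; apply: big1 => s _; rewrite sfac0.
have -> : \prod_(r < n) \prod_(s < n | (r < s)%N) sfac (b * x r * x s) (0 + 0) = 1.
  by apply: big1 => r _; apply: big1 => s _; rewrite sfac0.
have -> : \prod_(r < n) x r ^+ 0 = 1 by apply: big1.
have -> : (\sum_(r < n) \sum_(s < n | (r < s)%N) 0 * 0 = 0)%N.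
  by apply: big1 => r _; apply: big1.
set P1 := \prod_(s < n) (sfac _ _ * _); set P2 := \prod_(r < n) \prod_(s < n) sfac _ _.
have -> : P1 = P2.
  rewrite /P1 /P2 exchange_big /=; apply: eq_bigr => s _; rewrite sfac0 mul1r.
  apply: eq_bigr => r _; rewrite !expr0 !mulr1 subn0; congr (sfac _ _).
  by field; rewrite a0 g1.
have P20 : P2 != 0.
  apply/prodf_neq0 => r _; apply/prodf_neq0 => s _; rewrite !expr0 !mulr1; exact: nz.
rewrite !sfac0 ?expr0 !mul1r !mulr1 invr1 mulr1 mulfVK //.
rewrite -!big_split /=; apply: eq_bigr => r _.
rewrite ?expr0 ?mulr1 ?subn0 ?addn0 ?divr1.
have -> : a * x r * q / d = b * e * x r / a.
  apply: (mulIf d0); apply: (mulIf a0); rewrite mulfVK //.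
  by transitivity (b * d * e * x r); [rewrite bal; ring | field].
have -> : a * x r * q / e = b * d * x r / a.
  apply: (mulIf e0); apply: (mulIf a0); rewrite mulfVK //.
  by transitivity (b * d * e * x r); [rewrite bal; ring | field].
by have h := nz_ax r (N r); field; rewrite h.
Qed.

Section Degree.
Variables (x : 'I_n -> F) (a d : F) (N : 'I_n -> nat).
Hypotheses (x0 : forall r, x r != 0) (a0 : a != 0) (d0 : d != 0).
Let K := q * a ^+ 2 / (b * d).
Let K0 : K != 0. Proof. by rewrite !mulf_neq0 ?invr_neq0 ?mulf_neq0 ?expf_neq0. Qed.

Let degree_sfac v m : v != 0 ->
  theta_degree th K m (fun c => sfac (v * c) m * sfac (v * K / c) m).
Proof.
move=> v0; have -> : m = (\sum_(i <- index_iota 0 m) 1)%N.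
  by rewrite sum1_size size_iota subn0.
rewrite {2 3}(_ : (\sum_(i <- index_iota 0 m) 1)%N = m); last first.
  by rewrite sum1_size size_iota subn0.
refine (theta_degree_eq _ (theta_degree_prod (index_iota 0 m)
  (fun i => theta_degree_sym thP K0 (mulf_neq0 v0 (qX i))))) => c c0 /=.
rewrite /sfac -big_split /=; apply: eq_bigr => i _; rewrite /theta_sym.
by congr (th _ * th _); ring.
Qed.

Let degree_gfac j : (forall r, j r <= N r)%N ->
  theta_degree th K (weight N) (fun c => gfac x a N j c * gfac x a N j (K / c)).
Proof.
move=> jN.
have -> : weight N = (weight j + \sum_(s < n) (N s - j s))%N.
  by rewrite /weight -big_split /=; apply: eq_bigr => s _; rewrite subnKC.
pose v s := a * (x s * q ^+ j s) * q / K.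
have v0 s : v s != 0 by rewrite /v !mulf_neq0 ?invr_neq0.
refine (theta_degree_eq _ (theta_degreeM (degree_sfac (weight j) (oner_neq0 F))
  (theta_degree_prod (index_enum 'I_n) (fun s => degree_sfac (N s - j s) (v0 s))))) => c c0 /=.
rewrite big_split /= !mul1r /gfac.
have -> : \prod_(s < n) sfac (v s * c) (N s - j s) =
  \prod_(s < n) sfac (a * (x s * q ^+ j s) * q / (K / c)) (N s - j s).
  apply: eq_bigr => s _; congr (sfac _ _); rewrite /v; field.
  by rewrite c0 K0.
have -> : \prod_(s < n) sfac (v s * K / c) (N s - j s) =
  \prod_(s < n) sfac (a * (x s * q ^+ j s) * q / c) (N s - j s).
  by apply: eq_bigr => s _; congr (sfac _ _); rewrite /v mulfVK.
by ring.
Qed.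

(** The c-dependent part of each term is a product of |j| factors from the
    factorials of c and of K / c, and of |N| - |j| factors from the factorials with
    c and K / c in the denominator. *)
Lemma jackson_degree : theta_degree th K (weight N)
  (fun c => jackson_sum x a N c d (K / c) - jackson_prod x a N c d (K / c)).
Proof.
pose f1 c := \sum_(j : {dffun forall r : 'I_n, 'I_(N r).+1})
  (core x a N (fun r => j r : nat) * \prod_(s < n) gfac x a N (fun r => j r : nat) (a * x s)
     * gfac x a N (fun r => j r : nat) d) *
  (gfac x a N (fun r => j r : nat) c * gfac x a N (fun r => j r : nat) (K / c)).
pose f2 c := - \prod_(r < n) (th (a * x r) * sfac (b * d * x r / a) (N r)) *
  \prod_(r < n) (sfac (b * x r / a * c) (N r) * sfac (b * x r / a * K / c) (N r)).
have v0 r : b * x r / a != 0 by rewrite !mulf_neq0 ?invr_neq0.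
have deg1 : theta_degree th K (weight N) f1.
  apply: theta_degree_sum => j _; apply: theta_degreeZ; apply: degree_gfac => r.
  by rewrite -ltnS ltn_ord.
have deg2 : theta_degree th K (weight N) f2.
  by apply: theta_degreeZ; apply: (theta_degree_prod _ (fun r => degree_sfac (N r) (v0 r))).
refine (theta_degree_eq _ (theta_degreeD deg1 deg2)) => c c0.
congr (_ + _); first by apply: eq_bigr => j _; rewrite /jackson_term; ring.
rewrite /f2 mulNr -big_split /=; congr (- _); apply: eq_bigr => r _.
have -> : b * x r / a * c = b * c * x r / a by ring.
have -> : b * x r / a * K / c = b * (K / c) * x r / a by ring.
by ring.
Qed.
End Degree.
End Jackson.

Section JacksonTheorem.
Variables (F : fieldType) (th : F -> F) (q b : F) (n : nat).
Hypotheses (thP : theta_like th) (q0 : q != 0) (b0 : b != 0).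
Hypothesis q_generic : forall m, th (q ^+ m.+1) != 0.
Local Notation jsum := (jackson_sum th q b).
Local Notation jprod := (jackson_prod th q b).
Implicit Types (x : 'I_n -> F) (N j l : 'I_n -> nat).

Let jackson_sumC x a N c d e : jsum x a N c d e = jsum x a N d c e.
Proof. by apply: eq_bigr => j _; rewrite /jackson_term; ring. Qed.

Let jackson_prodC x a N c d e : jprod x a N c d e = jprod x a N d c e.
Proof. by apply: eq_bigr => r _; ring. Qed.

Let node x a N (i : option {r : 'I_n & 'I_(N r)}) : F :=
  if i is Some rk then a * x (tag rk) * q ^+ (tagged rk).+1 else 1.

Let card_node N : #|{: option {r : 'I_n & 'I_(N r)}}| = (weight N).+1.
Proof.
rewrite card_option card_tagged sumnE big_map /weight; congr S.
by rewrite big_enum /=; apply: eq_bigr => r _; rewrite card_ord.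
Qed.

Let node_neq0 x a N i : (forall r, x r != 0) -> a != 0 -> @node x a N i != 0.
Proof.
by move=> x0 a0; case: i => [[r k]|] /=; rewrite ?oner_neq0 // !mulf_neq0 ?expf_neq0.
Qed.

Let th_quotient_power i k : (i != k)%N -> th (q ^+ i / q ^+ k) != 0.
Proof.
have lt u v : (u < v)%N -> th (q ^+ v / q ^+ u) != 0.
  move=> uv; have -> : q ^+ v / q ^+ u = q ^+ (v - u.+1).+1.
    by rewrite -{1}(subnKC uv) addSnnS exprD mulrAC divff ?mul1r // expf_neq0.
  exact: q_generic.
rewrite neq_ltn => /orP[ik|ki]; last exact: lt.
by rewrite -invf_div (thetaV_eq0 thP) ?mulf_neq0 ?invr_neq0 ?expf_neq0 // lt.
Qed.

Let node_apart x a N i i' : generic th q b x a -> a != 0 -> i != i' ->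
  th (@node x a N i / @node x a N i') != 0.
Proof.
case=> g1 g2 g3 g4 a0.
case: i => [[r k]|]; case: i' => [[s m]|] //= ii.
- have [er|rs] := eqVneq r s.
    move: m ii; rewrite -er => m ii.
    have -> : a * x r * q ^+ k.+1 / (a * x r * q ^+ m.+1) = q ^+ k.+1 / q ^+ m.+1.
      by field; rewrite g1 a0 expf_neq0.
    apply: th_quotient_power; rewrite eqSS; apply: contraNN ii => /eqP/val_inj ->.
    by [].
  have -> : a * x r * q ^+ k.+1 / (a * x s * q ^+ m.+1) = x r * q ^+ k.+1 / (x s * q ^+ m.+1).
    by field; rewrite g1 a0 expf_neq0.
  exact: g4.
- by rewrite divr1; exact: g2.
- rewrite mul1r (thetaV_eq0 thP) ?g2 // !mulf_neq0 ?expf_neq0 //.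
Qed.

(** For fixed d, both sides are of degree |N| in c. They agree at the |N| + 1
    nodes, by [jackson_sum_1] and by the induction hypothesis combined with
    [jackson_sum_shift]. The nodes are apart for d in general position, and any
    other d is reached by interpolating in d. *)
Theorem elliptic_jackson N x a c d e : generic th q b x a ->
  a != 0 -> c != 0 -> d != 0 -> e != 0 -> b * c * d * e = q * a ^+ 2 ->
  jsum x a N c d e = jprod x a N c d e.
Proof.
have [m Em] := ubnP (weight N); elim: m => // m IH in N x a c d e Em *.
move=> gx a0; have [g1 g2 g3 g4] := gx.
have qa : q * a ^+ 2 != 0 by rewrite mulf_neq0 // expf_neq0.
have at_node d' e' (i : option {r : 'I_n & 'I_(N r)}) : d' != 0 -> e' != 0 ->
    b * node x a i * d' * e' = q * a ^+ 2 ->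
    jsum x a N (node x a i) d' e' = jprod x a N (node x a i) d' e'.
  case: i => [[rho k]|] d0 e0; last by rewrite mulr1 => h; exact: jackson_sum_1.
  rewrite /node /=; set c' := a * _ * _ => bal.
  pose l := single rho k.+1.
  pose N' r := (N r - l r)%N.
  have EN : N = addv N' l.
    apply/funext => r; rewrite /addv /N' subnK // /l /single.
    by case: eqP => // ->.
  have wl : weight l = k.+1 by exact: weight_single.
  have wN : weight N = (weight N' + k.+1)%N by rewrite {1}EN weight_addv wl.
  have qk : q ^+ k.+1 != 0 by rewrite expf_neq0.
  have gx' : generic th q b (dilate q x l) (a * q ^+ k.+1).
    by rewrite -wl; exact: (generic_dilate q0).
  rewrite {1 2}EN (@jackson_sum_shift _ _ _ b _ thP q0 b0 x a N' c' d' e' rho k.+1) //.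
  rewrite IH ?mulf_neq0 //; first exact: jackson_prod_shift.
    by move: Em; rewrite wN; lia.
  transitivity (b * c' * d' * e' * (q ^+ k.+1) ^+ 2); first by ring.
  by rewrite bal; ring.
pose good d' := forall i i', i != i' ->
  theta_apart th (q * a ^+ 2 / (b * d')) (@node x a N i) (@node x a N i').
have generic_d d' : d' != 0 -> good d' -> forall c' e', c' != 0 -> e' != 0 ->
    b * c' * d' * e' = q * a ^+ 2 -> jsum x a N c' d' e' = jprod x a N c' d' e'.
  move=> d0 gd c' e' c0 e0 bal; set K := q * a ^+ 2 / (b * d').
  have K0 : K != 0 by rewrite !mulf_neq0 // invr_neq0 // mulf_neq0.
  have eK : e' = K / c' by rewrite /K -bal; field; rewrite b0 d0 c0.
  apply/eqP; rewrite -subr_eq0 eK; apply/eqP.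
  have deg := @jackson_degree F th q b n thP q0 b0 x a d' N g1 a0 d0.
  apply: (theta_degree_interpolation thP K0 deg (pt := @node x a N)) => //.
  - by rewrite card_node.
  - by move=> i; exact: node_neq0.
  - move=> i; apply/eqP; rewrite subr_eq0; apply/eqP.
    have ni := node_neq0 i g1 a0.
    apply: at_node => //; first by rewrite mulf_neq0 ?invr_neq0.
    by rewrite /K; field; rewrite b0 d0 ni.
move=> c0 d0 e0 bal; set K := q * a ^+ 2 / (b * c).
have K0 : K != 0 by rewrite !mulf_neq0 // invr_neq0 // mulf_neq0.
have eK : e = K / d by rewrite /K -bal; field; rewrite b0 d0 c0.
pose us := [seq b * @node x a N i.1 * @node x a N i.2 / (q * a ^+ 2) |
  i <- enum {: option {r : 'I_n & 'I_(N r)} * option {r : 'I_n & 'I_(N r)}}].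
have us0 : all (fun u => u != 0) us.
  apply/allP => _ /mapP[i _ ->].
  by rewrite !mulf_neq0 ?invr_neq0 // node_neq0.
have [pt [pt0 ptus ptK]] := theta_generic_points thP (weight N).+1 K0 us0.
rewrite jackson_sumC jackson_prodC; apply/eqP; rewrite -subr_eq0 eK; apply/eqP.
have deg := @jackson_degree F th q b n thP q0 b0 x a c N g1 a0 c0.
apply: (theta_degree_interpolation thP K0 deg (pt := pt)) => //; first by rewrite card_ord.
move=> i; apply/eqP; rewrite subr_eq0; apply/eqP.
rewrite jackson_sumC jackson_prodC; apply: generic_d => //.
- move=> k k' kk; rewrite /theta_apart node_apart //=.
  have nk := node_neq0 k g1 a0; have nk' := node_neq0 k' g1 a0.
  have -> : q * a ^+ 2 / (b * pt i) / (node x a k * node x a k') =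
     (b * node x a k * node x a k' / (q * a ^+ 2) * pt i)^-1.
    by field; rewrite q0 a0 b0 pt0 nk nk'.
  rewrite (thetaV_eq0 thP) ?mulf_neq0 ?invr_neq0 //.
  by apply: (allP (ptus i)); apply/mapP; exists (k, k') => //; rewrite mem_enum.
- by rewrite mulf_neq0 ?invr_neq0.
- by rewrite /K; field; rewrite b0 c0 pt0.
Qed.
End JacksonTheorem.

(** * The Bailey pair *)

Section BaileyTerm.
Variables (F : fieldType) (th : F -> F) (q b : F) (n : nat).
Hypotheses (thP : theta_like th) (q0 : q != 0) (b0 : b != 0).
Local Notation sfac := (sfac th q).

(** [qpfac] with an arbitrary function in place of [theta p], so that the
    manipulation of products does not involve the limits defining theta. *)
Definition zfac (a : F) (k : int) : F :=
  match k with
  | Posz m => \prod_(0 <= j < m) th (a * q ^+ j)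
  | Negz m => (\prod_(0 <= j < m.+1) th (a * q ^- j.+1))^-1
  end.

Arguments zfac : simpl never.

Lemma zfac_nat a (m : nat) : zfac a m = sfac a m.
Proof. by []. Qed.

Lemma zfacN a m : zfac a (- m%:Z) = (sfac (a / q ^+ m) m)^-1.
Proof.
case: m => [|m]; first by rewrite oppr0 zfac_nat !sfac0 invr1.
rewrite -NegzE /zfac /sfac; congr (_^-1); rewrite big_nat_rev /=.
rewrite big_nat [RHS]big_nat; apply: eq_bigr => i /andP[_ im]; congr th.
rewrite add0n subSS; have -> : q ^+ m.+1 = q ^+ (m - i).+1 * q ^+ i.
  by rewrite -exprD; congr (_ ^+ _); lia.
by field; rewrite !expf_neq0.
Qed.

(** The two lengths differ by N - j, hence the quotient is a factorial of natural
    length whatever the signs of N - w and j - w. *)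
Lemma zfac_ratio y (N j w : nat) : (j <= N)%N -> zfac y (j%:Z - w%:Z) != 0 ->
  zfac y (N%:Z - w%:Z) / zfac y (j%:Z - w%:Z) = sfac (y * q ^+ j / q ^+ w) (N - j).
Proof.
have qX k : q ^+ k != 0 by rewrite expf_neq0.
move=> jN; have [wj|jw] := leqP w j.
  rewrite !subzn ?(leq_trans wj) // !zfac_nat => nz.
  have -> : (N - w = (j - w) + (N - j))%N by lia.
  rewrite sfacD mulrAC divff // mul1r; congr (sfac _ _).
  by rewrite -{2}(subnK wj) exprD; field; rewrite !qX.
have -> : j%:Z - w%:Z = - (w - j)%N%:Z by rewrite -subzn ?opprB // ltnW.
rewrite zfacN invr_eq0 invrK => nz.
have ej : y / q ^+ (w - j) = y * q ^+ j / q ^+ w.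
  by rewrite -{2}(subnK (ltnW jw)) exprD; field; rewrite !qX.
rewrite ej in nz *.
have [wN|Nw] := leqP w N.
  rewrite subzn // zfac_nat.
  have -> : (N - j = (w - j) + (N - w))%N by lia.
  rewrite sfacD mulrC; congr (_ * sfac _ _).
  by rewrite -{1}(subnK (ltnW jw)) exprD; field; rewrite !qX.
have -> : N%:Z - w%:Z = - (w - N)%N%:Z by rewrite -subzn ?opprB // ltnW.
rewrite zfacN.
have e : (w - j = (N - j) + (w - N))%N by lia.
have es : sfac (y * q ^+ j / q ^+ w) (w - j) =
    sfac (y * q ^+ j / q ^+ w) (N - j) * sfac (y / q ^+ (w - N)) (w - N).
  rewrite {1}e sfacD; congr (_ * sfac _ _).
  have -> : q ^+ w = q ^+ (w - N) * q ^+ (N - j) * q ^+ j.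
    by rewrite -!exprD; congr (_ ^+ _); lia.
  by field; rewrite !qX.
rewrite es in nz *.
have nz' : sfac (y / q ^+ (w - N)) (w - N) != 0.
  by apply: contraNneq nz => ->; rewrite mulr0.
by rewrite mulrC mulfK.
Qed.

Implicit Types (N j : 'I_n -> nat).
Variables (x : 'I_n -> F) (a c d : F).
Hypotheses (gx : generic th q b x a) (a0 : a != 0) (c0 : c != 0) (d0 : d != 0).
Let e := q * a ^+ 2 / (b * c * d).
Hypothesis q_generic : forall m, th (q ^+ m.+1) != 0.
Hypothesis h_theta : forall r, th (a * x r) != 0.
Hypothesis h_aqc : forall r m, sfac (a * x r * q / c) m != 0.
Hypothesis h_aqd : forall r m, sfac (a * x r * q / d) m != 0.
Hypothesis h_bcd : forall r m, sfac (b * c * d * x r / a) m != 0.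
Hypothesis h_bxa : forall j r, zfac (b * x r / a) ((j r)%:Z - (weight j)%:Z) != 0.

Definition zfacs (s : seq F) (k : int) : F := \prod_(y <- s) zfac y k.

Let P y N := \prod_(r < n) sfac (a * x r * q / y) (N r).
Let Q N := \prod_(r < n) \prod_(s < n) sfac (q * x r / x s) (N r).

Let scale N := \prod_(r < n) \prod_(s < n) sfac (b * x r * x s) (N r)
  / (\prod_(r < n) th (a * x r) * Q N * (P c N * P d N * P e N)).

Let e0 : e != 0. Proof. by rewrite !mulf_neq0 ?invr_neq0 ?mulf_neq0 ?expf_neq0. Qed.
Let bal : b * c * d * e = q * a ^+ 2.
Proof. by rewrite /e; field; rewrite b0 c0 d0. Qed.

Let aqe r : a * x r * q / e = b * c * d * x r / a.
Proof. by rewrite /e; field; rewrite q0 a0 b0 c0 d0. Qed.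

Let P_neq0 y N : y \in [:: c; d; e] -> P y N != 0.
Proof.
rewrite !inE => /or3P[] /eqP ->; apply/prodf_neq0 => r _ //.
by rewrite aqe.
Qed.

Let Q_neq0 N : Q N != 0.
Proof.
apply/prodf_neq0 => r _; apply/prodf_neq0 => s _; apply: sfac_neq0 => m _.
have [->|rs] := eqVneq r s; first by rewrite mulfK ?(gen_x gx) // -exprS.
have := gen_xx gx m.+1 0 rs; rewrite expr0 mulr1 exprS.
by apply: contraNN => /eqP h; apply/eqP; rewrite -[RHS]h; congr th; ring.
Qed.

(** Separates the part that depends on N alone, which goes into the common
    factor [scale]. *)
Let gfacE N j y : (forall r, j r <= N r)%N -> y != 0 -> P y j != 0 ->
  gfac th q x a N j y = sfac y (weight j) * P y N / P y j.
Proof.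
move=> jN y0 Pn; rewrite /gfac -mulrA; congr (_ * _); apply: (mulIf Pn).
rewrite mulfVK // /P -big_split /=; apply: eq_bigr => s _.
rewrite -{2}(subnKC (jN s)) sfacD mulrC; congr (_ * sfac _ _).
by field; rewrite y0.
Qed.

Let prod_gfacE N j : (forall r, j r <= N r)%N ->
  \prod_(s < n) gfac th q x a N j (a * x s) =
  \prod_(s < n) sfac (a * x s) (weight j) * Q N / Q j.
Proof.
move=> jN; rewrite /gfac big_split /= -mulrA; congr (_ * _); apply: (mulIf (Q_neq0 j)).
rewrite mulfVK // [X in X * _]exchange_big /Q -big_split /=; apply: eq_bigr => r _.
rewrite -big_split /=; apply: eq_bigr => s _.
rewrite -[in RHS](subnKC (jN r)) sfacD mulrC; congr (_ * sfac _ _).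
by field; rewrite a0 (gen_x gx).
Qed.

Lemma bailey_term N j : (forall r, j r <= N r)%N ->
  (\prod_(r < n) \prod_(s < n) zfac (b * x r * x s) (N r + j s)%N)
  / ((\prod_(r < n) \prod_(s < n | (r < s)%N) zfac (b * x r * x s) (j r + j s)%N)
     * (\prod_(r < n) \prod_(s < n)
          zfac (q ^ (1 + (j r)%:Z - (j s)%:Z) * x r / x s) ((N r)%:Z - (j r)%:Z)))
  * \prod_(r < n)
      (zfac (b * x r / a) ((N r)%:Z - (weight j)%:Z)
       / (zfac (b * x r / a) ((j r)%:Z - (weight j)%:Z)
          * zfac (a * x r * q) (N r + weight j)%N))
  * ((\prod_(r < n)
     (th (a * x r * q ^+ (j r + weight j)) / th (a * x r)
      * (zfac (a * x r) (weight j)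
         / zfacs [:: a * x r * q / c; a * x r * q / d; b * c * d * x r / a] (j r))))
    * (zfacs [:: c; d; q * a ^+ 2 / (b * c * d)] (weight j)
       / \prod_(r < n) \prod_(s < n) zfac (q * x r / x s) (j r))
    * (b / a) ^+ weight j
    * q ^- (\sum_(r < n) \sum_(s < n | (r < s)%N) j r * j s)%N
    * \prod_(r < n) x r ^+ j r)
  = scale N * jackson_term th q b x a N c d e j.
Proof.
move=> jN; rewrite /jackson_term prod_gfacE //.
rewrite !gfacE ?P_neq0 ?inE ?eqxx ?orbT //.
rewrite /core /power_part.
have -> : \prod_(r < n) \prod_(s < n) zfac (b * x r * x s) (N r + j s)%N =
  \prod_(r < n) \prod_(s < n) sfac (b * x r * x s) (N r) *
  \prod_(r < n) \prod_(s < n) sfac (b * (x r * q ^+ N r) * x s) (j s).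
  rewrite -big_split /=; apply: eq_bigr => r _; rewrite -big_split /=; apply: eq_bigr => s _.
  by rewrite zfac_nat sfacD; congr (_ * sfac _ _); ring.
have -> : \prod_(r < n) \prod_(s < n)
      zfac (q ^ (1 + (j r)%:Z - (j s)%:Z) * x r / x s) ((N r)%:Z - (j r)%:Z) =
  \prod_(r < n) \prod_(s < n)
        sfac (q * (x r * q ^+ j r) / (x s * q ^+ j s)) (N r - j r).
  apply: eq_bigr => r _; apply: eq_bigr => s _; rewrite subzn // zfac_nat.
  congr (sfac _ _); rewrite !expfzDr // -invr_expz expr1z -!exprnP.
  by field; rewrite (gen_x gx) expf_neq0.
have -> : \prod_(r < n)
      (zfac (b * x r / a) ((N r)%:Z - (weight j)%:Z)
       / (zfac (b * x r / a) ((j r)%:Z - (weight j)%:Z)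
          * zfac (a * x r * q) (N r + weight j)%N)) =
   \prod_(r < n) sfac (b * (x r * q ^+ j r) / (a * q ^+ weight j)) (N r - j r) /
   \prod_(r < n) sfac (a * x r * q) (N r + weight j).
  rewrite -prodf_div; apply: eq_bigr => r _; rewrite [(zfac _ _ * zfac _ _)^-1]invfM [LHS]mulrA zfac_ratio //.
  congr (sfac _ _ / _); field; by rewrite a0 expf_neq0.
have -> : \prod_(r < n)
     (th (a * x r * q ^+ (j r + weight j)) / th (a * x r)
      * (zfac (a * x r) (weight j)
         / zfacs [:: a * x r * q / c; a * x r * q / d; b * c * d * x r / a] (j r))) =
   \prod_(r < n) th (a * q ^+ weight j * (x r * q ^+ j r)) / \prod_(r < n) th (a * x r) *
   (\prod_(r < n) sfac (a * x r) (weight j) / (P c j * P d j * P e j)).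
  rewrite /P -!big_split /= -!prodf_div -big_split /=; apply: eq_bigr => r _.
  rewrite /zfacs !big_cons big_nil mulr1 !zfac_nat aqe.
  by congr (th _ / _ * (_ / _)); [rewrite exprD; ring | rewrite [LHS]mulrA].
have -> : zfacs [:: c; d; q * a ^+ 2 / (b * c * d)] (weight j) =
   sfac c (weight j) * sfac d (weight j) * sfac e (weight j).
  by rewrite /zfacs !big_cons big_nil mulr1 mulrA.
rewrite !big_split /= !prodfV /scale -/(Q j).
have Th0 : \prod_(r < n) th (a * x r) != 0 by apply/prodf_neq0 => r _.
have hc : P c N != 0 by apply: P_neq0; rewrite !inE eqxx ?orbT.
have hd : P d N != 0 by apply: P_neq0; rewrite !inE eqxx ?orbT.
have he : P e N != 0 by apply: P_neq0; rewrite !inE eqxx ?orbT.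
have hc' : P c j != 0 by apply: P_neq0; rewrite !inE eqxx ?orbT.
have hd' : P d j != 0 by apply: P_neq0; rewrite !inE eqxx ?orbT.
have he' : P e j != 0 by apply: P_neq0; rewrite !inE eqxx ?orbT.
have hQ := Q_neq0 N; have hQ' := Q_neq0 j.
have -> : \prod_(r < n) \prod_(s < n | (r < s)%N) zfac (b * x r * x s) (j r + j s)%N =
  \prod_(r < n) \prod_(s < n | (r < s)%N) sfac (b * x r * x s) (j r + j s) by [].
move: Th0 hc hd he hc' hd' he' hQ hQ'.
set X1 := \prod_(r < n) \prod_(s < n) sfac _ (N r).
set Y1 := \prod_(r < n) \prod_(s < n) sfac _ (j s).
set D := (_ * \prod_(r < n) \prod_(s < n) sfac _ (N r - j r))^-1.
set SB := \prod_(r < n) sfac _ (N r - j r).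
set SA := (\prod_(r < n) sfac _ (N r + weight j))^-1.
set T1 := \prod_(r < n) th (a * q ^+ _ * _); set T0 := \prod_(r < n) th (a * x r).
set A0 := \prod_(r < n) sfac (a * x r) _; set PW := _ ^+ weight j.
set PQ := (q ^+ _)^-1; set PX := \prod_(r < n) x r ^+ j r.
move=> Th0 hc hd he hc' hd' he' hQ hQ'; field.
by rewrite Th0 hc hd he hc' hd' he' hQ hQ'.
Qed.

Lemma bailey_prod N :
  (\prod_(r < n) \prod_(s < n)
     (zfac (b * x r * x s) (N s) / zfac (q * x r / x s) (N r)))
  * \prod_(r < n)
      (zfacs [:: a * x r * q / (c * d); b * c * x r / a; b * d * x r / a] (N r)
       / zfacs [:: b * c * d * x r / a; a * x r * q / c; a * x r * q / d] (N r))
  = scale N * jackson_prod th q b x a N c d e.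
Proof.
have Th0 : \prod_(r < n) th (a * x r) != 0 by apply/prodf_neq0 => r _.
have hc : P c N != 0 by apply: P_neq0; rewrite !inE eqxx ?orbT.
have hd : P d N != 0 by apply: P_neq0; rewrite !inE eqxx ?orbT.
have he : P e N != 0 by apply: P_neq0; rewrite !inE eqxx ?orbT.
have hQ := Q_neq0 N.
rewrite /jackson_prod /scale.
have -> : \prod_(r < n) \prod_(s < n)
     (zfac (b * x r * x s) (N s) / zfac (q * x r / x s) (N r)) =
  \prod_(r < n) \prod_(s < n) sfac (b * x r * x s) (N r) / Q N.
  under eq_bigr => r _ do rewrite prodf_div.
  rewrite prodf_div; congr (_ / _); rewrite exchange_big /=.
  by apply: eq_bigr => s _; apply: eq_bigr => r _; rewrite zfac_nat mulrAC.
have -> : \prod_(r < n)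
      (zfacs [:: a * x r * q / (c * d); b * c * x r / a; b * d * x r / a] (N r)
       / zfacs [:: b * c * d * x r / a; a * x r * q / c; a * x r * q / d] (N r)) =
  \prod_(r < n) (sfac (b * c * x r / a) (N r) * sfac (b * d * x r / a) (N r)
     * sfac (b * e * x r / a) (N r)) / (P e N * P c N * P d N).
  rewrite /P -!big_split /= -prodf_div; apply: eq_bigr => r _.
  rewrite /zfacs !big_cons big_nil mulr1 !zfac_nat -aqe.
  have -> : a * x r * q / (c * d) = b * e * x r / a.
    by rewrite /e; field; rewrite a0 b0 c0 d0.
  by congr (_ / _); rewrite ?mulrA //; ring.
rewrite [in RHS]big_split /=.
set X1 := \prod_(r < n) \prod_(s < n) _; set Y := \prod_(r < n) (_ * _ * _).
by field; rewrite Th0 hc hd he hQ.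
Qed.

Lemma bailey_sum N :
  scale N * jackson_prod th q b x a N c d e =
  \sum_(j : {dffun forall r : 'I_n, 'I_(N r).+1})
     scale N * jackson_term th q b x a N c d e (fun r => j r : nat).
Proof. by rewrite -mulr_sumr -(elliptic_jackson thP q0 b0 q_generic N gx). Qed.
End BaileyTerm.

Lemma theta_like_theta (R : realType) (p : R[i]) : normc p < 1 -> theta_like (theta p).
Proof.
move=> hp; split=> [|a a0|K u w c c0 K0 u0 w0 cn c00|us us0].
- exact: theta_1.
- exact: thetaV.
- exact: theta_three_term.
- exact: theta_avoid.
Qed.

Lemma sfac_factor_neq0 (F : fieldType) (th : F -> F) (q a : F) m k :
  (m < k)%N -> sfac th q a k != 0 -> th (a * q ^+ m) != 0.
Proof.
move=> mk; rewrite /sfac big_mkord => /prodf_neq0 h.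
exact: (h (Ordinal mk)).
Qed.

Theorem theorem8p2 (R : realType) (n : nat) (hn : (1 <= n)%N)
    (q p : R[i]) (hq : q != 0) (hp : `|p| < 1)
    (x : 'I_n -> R[i]) (hx : forall r, x r != 0)
    (a b c d : R[i]) (ha : a != 0) (hb : b != 0) (hc : c != 0) (hd : d != 0)
    (* no denominator of alpha or beta vanishes *)
    (h_theta : forall r, theta p (a * x r) != 0)
    (h_aqc : forall r (m : nat), qpfac q p (a * x r * q / c) m != 0)
    (h_aqd : forall r (m : nat), qpfac q p (a * x r * q / d) m != 0)
    (h_bcd : forall r (m : nat), qpfac q p (b * c * d * x r / a) m != 0)
    (h_qxx : forall r s (m : nat), qpfac q p (q * x r / x s) m != 0)
    (* no denominator of an entry of B4 with j <= k vanishes *)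
    (h_bxx : forall (j : 'I_n -> nat) (r s : 'I_n), (r < s)%N ->
       qpfac q p (b * x r * x s) (j r + j s)%N != 0)
    (h_qjxx : forall (k j : 'I_n -> nat), (forall r, (j r <= k r)%N) ->
       forall r s, qpfac q p (q ^ (1 + (j r)%:Z - (j s)%:Z) * x r / x s)
                             ((k r)%:Z - (j r)%:Z) != 0)
    (h_bxa : forall (j : 'I_n -> nat) (r : 'I_n),
       qpfac q p (b * x r / a) ((j r)%:Z - (weight j)%:Z) != 0)
    (h_axq : forall (k j : 'I_n -> nat) (r : 'I_n),
       qpfac q p (a * x r * q) (k r + weight j)%N != 0) :
  WP_Bailey_pair (B4 q p x a b) (alpha4 q p x c d a b) (beta4 q p x c d a b).
Proof.
have hp' : normc p < 1 by rewrite -ltcR -normcE.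
have thP := theta_like_theta hp'.
have q_generic m : theta p (q ^+ m.+1) != 0.
  have r0 := Ordinal hn; have := sfac_factor_neq0 (ltnSn m) (h_qxx r0 r0 m.+1).
  by rewrite mulfK // -exprS.
have gx : generic (theta p) q b x a.
  have lt_bxx (r s : 'I_n) m : (r < s)%N -> theta p (b * x r * x s * q ^+ m) != 0.
    move=> rs; apply: (sfac_factor_neq0 _ (h_bxx (fun=> m.+1) r s rs)).
    by rewrite addSn ltnS leq_addr.
  split=> // [r m|r s m rs|r s k m rs].
  - have := sfac_factor_neq0 (leq_addr _ _ : (m < m.+1 + _)%N) (h_axq (fun=> m.+1) (fun=> 0%N) r).
    by rewrite -[_ * q * _]mulrA -exprS.
  - move: rs; rewrite neq_ltn => /orP[|sr]; first exact: lt_bxx.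
    by rewrite [b * x r * x s]mulrAC; exact: lt_bxx.
  - (* this theta function divides the denominator with j_r = k and j_s = m + 1 *)
    pose j (t : 'I_n) : nat := if t == r then k else m.+1.
    have := h_qjxx (fun t => j t + 1)%N j (fun t => leq_addr _ _) r s.
    have -> : ((j r + 1)%N%:Z - (j r)%:Z) = 1%N by rewrite PoszD addrAC subrr add0r.
    move=> h; have := sfac_factor_neq0 (ltnSn 0) h.
    have -> : q ^ (1 + (j r)%:Z - (j s)%:Z) * x r / x s * q ^+ 0 =
      x r * q ^+ k / (x s * q ^+ m).
      rewrite /j eqxx eq_sym (negbTE rs) !expfzDr // -invr_expz expr1z -!exprnP exprS.
      by field; rewrite hx hq expf_neq0.
    by [].
move=> N.
apply: (etrans (bailey_prod hq hb gx ha hc hd q_generic h_theta h_aqc h_aqd h_bcd N)).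
apply: (etrans (bailey_sum thP hq hb gx ha hc hd q_generic N)).
apply: eq_bigr => j _; apply/esym.
apply: (bailey_term hq hb gx ha hc hd q_generic h_theta h_aqc h_aqd h_bcd h_bxa) => r.
by rewrite -ltnS ltn_ord.
Qed.
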